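(* Let $B_R=B_R(0)\subset\mathbb{R}^2$ be the disk of radius $R>0$ centered at the origin, and let $u(x)$ be a solution of degree $d\in\mathbb{N}$ of $$-\Delta u(x)=u(1-|u|^2),\quad x\in B_R(0),$$ with $$u(x)=e^{id\theta},\quad x\in\partial B_R(0),$$ satisfying the additional hypotheses that $u(x_0)=0$ if and only if $x_0=0$, and that $$\nabla\times v(x)=0,$$ where $v(x)=v(z,\overline z)$ is given by $$v(z,\overline z)=u\bigl(z^{1/d},\,\overline z^{\,1/d}\bigr).$$ Then $$u(x)=e^{id\theta}F_d(|x|),$$ where $F_d(|x|)$ is the unique non-negative solution of $$-F_d''(r)-\frac1r F_d'(r)+\frac{d^2}{r^2}F_d(r)=F_d(r)\bigl(1-F_d(r)^2\bigr),\quad r\in(0,R),$$ satisfying $F_d(0)=0$ and $F_d(R)=1$.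
   Context: Here $u$ is complex-valued, $\mathbb{N}=\{1,2,\dots\}$, and $(r,\theta)$ are polar coordinates of $x$. $\mathbb{R}^2$ is identified with $\mathbb{C}$ in the domain (the point $x$ corresponds to $z$, and a function of $x$ is written as a function of $(z,\overline z)$) and in the target (so $u$ and $v$ are regarded as planar vector fields). The degree is the winding number of $u$ along $\partial B_R$. The function $v$ is $u$ composed with the $d$-th root, viewed on the Riemann surface for the map $z\mapsto z^{1/d}$. For $v=(v_1,v_2)$, $\nabla\times v=\partial_1v_2-\partial_2v_1$. *)

(* Defs.v *)
(* Stdlib reals with Coquelicot.  The plane R^2 and the complex plane are both
   Coquelicot's [C = R * R]; planar maps are total functions [C -> C] of which
   only the values on the relevant disk matter. *)
From Stdlib Require Export Reals.
From Coquelicot Require Export Coquelicot.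
Open Scope R_scope.

Definition expi (t : R) : C := (cos t, sin t).

Definition polar (r t : R) : C := (r * expi t)%C.

Definition disk (rad : R) (x : C) : Prop := Cmod x < rad.
Definition closed_disk (rad : R) (x : C) : Prop := Cmod x <= rad.
Definition segment (a b t : R) : Prop := a <= t <= b.

Definition comp1 (u : C -> C) (x1 x2 : R) : R := fst (u (x1, x2)).
Definition comp2 (u : C -> C) (x1 x2 : R) : R := snd (u (x1, x2)).

(* Twice continuously differentiable in the real sense, when required at every
   point of an open set. *)
Definition C2_at (u : C -> C) (x : C) : Prop :=
  ex_diff_n (comp1 u) 2 (fst x) (snd x) /\
  ex_diff_n (comp2 u) 2 (fst x) (snd x).

Definition laplacian (f : R -> R -> R) (x : C) : R :=
  partial_derive 2 0 f (fst x) (snd x) + partial_derive 0 2 f (fst x) (snd x).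

Definition vlaplacian (u : C -> C) (x : C) : C :=
  (laplacian (comp1 u) x, laplacian (comp2 u) x).

Definition curl (v : C -> C) (z : C) : R :=
  partial_derive 1 0 (comp2 v) (fst z) (snd z)
  - partial_derive 0 1 (comp1 v) (fst z) (snd z).

(* Classical solution: C^2 in the open disk, continuous up to the boundary. *)
Definition GL_solution (rad : R) (u : C -> C) : Prop :=
  continuous_on (closed_disk rad) u /\
  forall x, disk rad x ->
    C2_at u x /\
    (- vlaplacian u x)%C = (u x * RtoC (1 - Cmod (u x) ^ 2))%C.

(* [n] is the total increment, divided by [2 * PI], of a continuous argument of
   the closed curve [gamma] on [0, 2 * PI], which avoids the origin. *)
Definition winding_number (gamma : R -> C) (n : Z) : Prop :=
  exists phi : R -> R,
    continuous_on (segment 0 (2 * PI)) phi /\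
    (forall t, segment 0 (2 * PI) t ->
       gamma t <> 0%C /\ gamma t = polar (Cmod (gamma t)) (phi t)) /\
    phi (2 * PI) - phi 0 = 2 * PI * IZR n.

Definition has_degree (rad : R) (u : C -> C) (d : nat) : Prop :=
  winding_number (fun t => u (polar rad t)) (Z.of_nat d).

(* [g] is a branch over the open set [U] of [z |-> z^(1/d)].  The pairs [(U, g)]
   are the sheets of the Riemann surface of the d-th root: [z] is a local
   coordinate on them.  The branch point [0] is in some [U] only if [d = 1]. *)
Definition root_branch (d : nat) (U : C -> Prop) (g : C -> C) : Prop :=
  open U /\
  (forall z, U z -> continuous g z) /\
  (forall z, U z -> (g z ^ d)%C = z).

(* [v = u (z^(1/d))] on the sheet given by the branch [g]. *)
Definition root_pullback (u g : C -> C) (z : C) : C := u (g z).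

(* Vanishing of the curl, taken in the coordinate [z], on the whole part of the
   Riemann surface that lies over the disk of radius [rad ^ d]. *)
Definition root_pullback_curl_free (rad : R) (d : nat) (u : C -> C) : Prop :=
  forall (U : C -> Prop) (g : C -> C),
    root_branch d U g ->
    (forall z, U z -> disk (rad ^ d) z) ->
    forall z, U z -> curl (root_pullback u g) z = 0.

Definition radial_solution (d : nat) (rad : R) (F : R -> R) : Prop :=
  continuous_on (segment 0 rad) F /\
  (forall r, 0 < r < rad ->
     ex_derive F r /\ ex_derive (Derive F) r /\
     - Derive_n F 2 r - 1 / r * Derive F r + INR d ^ 2 / r ^ 2 * F r
     = F r * (1 - F r ^ 2)) /\
  F 0 = 0 /\ F rad = 1.

Definition nonneg_radial_solution (d : nat) (rad : R) (F : R -> R) : Prop :=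
  radial_solution d rad F /\ forall r, segment 0 rad r -> 0 <= F r.

(* Uniqueness is as functions on [0, rad]; values elsewhere are irrelevant. *)
Definition unique_nonneg_radial_solution
    (d : nat) (rad : R) (F : R -> R) : Prop :=
  nonneg_radial_solution d rad F /\
  forall G, nonneg_radial_solution d rad G ->
    forall r, segment 0 rad r -> G r = F r.

(* Main.v *)
Require Import Defs.
From Stdlib Require Import Reals Lra Lia ZArith ClassicalEpsilon.
From Coquelicot Require Import Coquelicot.
Open Scope R_scope.

(* Write [u = e^(idt) (a + ib)] in polar coordinates [(r, t)] and [n = 1 - a^2 - b^2].
   The curl condition reads [r b_r + d b = a_t].  In the coordinate [z = w^d] it also makes
   [laplacian v] the gradient of [div v], and the equation says that this gradient is a
   multiple of [v]; equality of its mixed derivatives becomes the first-order relation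
   [a n_t = b (r n_r - 2 (d - 1) n)].  Together the two relations are a transport
   equation for [b^2 / (a^2 + b^2)] along [v], with [b = 0] on the boundary circle.  A maximum
   principle gives [b = 0] as long as [a > 0], going inwards from the boundary, and
   since [u] does not vanish away from the origin [a] never reaches [0].  Then
   [a_t = 0], so [a] is the radial profile; its uniqueness is a Wronskian argument. *)

(** * Calculus in the plane *)

(** The sheets of the Riemann surface enter only once: a branch [g] has derivative [w^(-k) / d] at a
    point with root [w], where [k = d - 1], and this expression is single-valued in [w]. From then
    on every relation lives on the punctured disk of [u] itself. Since [g] is holomorphic,
    [laplacian v] is [|g'|^2] times the Laplacian of [u] at [w], which is why it remains a real
    multiple of [v]. The resulting relations are of first order, so no elliptic maximum principle
    applies. At a critical angle the radial derivative of [b^2 / (a^2 + b^2)] can be negative, and a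
    power of [r] is put in front to make it positive. The weighted quantity then grows outwards at
    its maximum, so only the outer circle has to carry a condition and the singular origin is never
    touched. The argument divides by [a], whose positivity is known beforehand only on the boundary
    circle; this forces the detour through annuli and a continuation in the inner radius. *)

Definition dx (f : R -> R -> R) (x y : R) : R := Derive (fun z => f z y) x.
Definition dy (f : R -> R -> R) (x y : R) : R := Derive (fun z => f x z) y.

Definition open_2d (O : R -> R -> Prop) : Prop :=
  forall x y, O x y -> locally_2d O x y.

(** The derivatives are passed as explicit expressions, so that symmetry of second derivatives
    becomes an algebraic identity; this is how a pointwise relation is extracted from a known
    gradient. *)
Lemma schwarz_open (O : R -> R -> Prop) (f g1 g2 h12 h21 : R -> R -> R) :
  open_2d O ->
  (forall x y, O x y -> is_derive (fun z => f z y) x (g1 x y)) ->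
  (forall x y, O x y -> is_derive (fun z => f x z) y (g2 x y)) ->
  (forall x y, O x y -> is_derive (fun z => g1 x z) y (h12 x y)) ->
  (forall x y, O x y -> is_derive (fun z => g2 z y) x (h21 x y)) ->
  (forall x y, O x y -> continuity_2d_pt h12 x y) ->
  (forall x y, O x y -> continuity_2d_pt h21 x y) ->
  forall x y, O x y -> h12 x y = h21 x y.
Proof.
  intros HO H1 H2 H12 H21 C12 C21 x y Oxy.
  assert (E12 : forall u v, O u v ->
    is_derive (fun z => Derive (fun t => f t z) u) v (h12 u v)).
  { intros u v Ouv.
    apply (is_derive_ext_loc (fun z => g1 u z)); [|now apply H12].
    generalize (locally_2d_1d_const_x _ _ _ (HO u v Ouv)).
    apply filter_imp; intros t Ht; symmetry; apply is_derive_unique; now apply H1. }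
  assert (E21 : forall u v, O u v ->
    is_derive (fun z => Derive (fun t => f z t) v) u (h21 u v)).
  { intros u v Ouv.
    apply (is_derive_ext_loc (fun z => g2 z v)); [|now apply H21].
    generalize (locally_2d_1d_const_y _ _ _ (HO u v Ouv)).
    apply filter_imp; intros t Ht; symmetry; apply is_derive_unique; now apply H2. }
  rewrite <- (is_derive_unique _ _ _ (E12 x y Oxy)).
  rewrite <- (is_derive_unique _ _ _ (E21 x y Oxy)).
  symmetry; apply Schwarz.
  - generalize (HO x y Oxy); apply locally_2d_impl, locally_2d_forall.
    intros u v Ouv; repeat split; eexists;
      [apply H1|apply H2|apply E21|apply E12]; exact Ouv.
  - apply (continuity_2d_pt_ext_loc h21); [|now apply C21].
    generalize (HO x y Oxy); apply locally_2d_impl, locally_2d_forall.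
    intros u v Ouv; symmetry; apply is_derive_unique; now apply E21.
  - apply (continuity_2d_pt_ext_loc h12); [|now apply C12].
    generalize (HO x y Oxy); apply locally_2d_impl, locally_2d_forall.
    intros u v Ouv; symmetry; apply is_derive_unique; now apply E12.
Qed.

(** Total differentiability at the point comes from one continuous partial derivative together with
    the existence of the other. *)
Lemma chain_2d (O : R -> R -> Prop) (f : R -> R -> R) (X Y : R -> R) (s X' Y' : R) :
  open_2d O ->
  (forall x y, O x y -> ex_diff_n f 1 x y) ->
  O (X s) (Y s) -> is_derive X s X' -> is_derive Y s Y' ->
  is_derive (fun t => f (X t) (Y t)) s
    (dx f (X s) (Y s) * X' + dy f (X s) (Y s) * Y').
Proof.
  intros HO Hf Os HX HY.
  apply is_derive_Reals.
  apply (derivable_pt_lim_comp_2d f X Y);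
    [|now apply is_derive_Reals|now apply is_derive_Reals].
  apply filterdiff_differentiable_pt_lim.
  destruct (Hf _ _ Os) as (_ & _ & E2 & (C1 & _) & _).
  apply (filterdiff_ext_lin _ (fun u : R * R =>
    plus (scal (fst u) (dx f (X s) (Y s))) (scal (snd u) (dy f (X s) (Y s))))).
  2: reflexivity.
  apply (is_derive_filterdiff f (X s) (Y s) (dx f)).
  - apply (locally_2d_locally (fun u v => is_derive (fun z => f z v) u (dx f u v))).
    generalize (HO _ _ Os); apply locally_2d_impl, locally_2d_forall.
    intros u v Ouv; apply Derive_correct, (Hf u v Ouv).
  - now apply Derive_correct.
  - now apply continuity_2d_pt_filterlim in C1.
Qed.

(** The function [w^(-k)]: for [d = k + 1] it is, up to the factor [1/d], the derivative of the d-th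
    root at the point whose root is [w]. The two parts are kept apart because only real partial
    derivatives are taken. *)
Definition zinv (k : nat) (x y : R) : C := ((/ (x, y)) ^ k)%C.
Definition zre (k : nat) (x y : R) : R := fst (zinv k x y).
Definition zim (k : nat) (x y : R) : R := snd (zinv k x y).

Definition punctured (x y : R) : Prop := x ^ 2 + y ^ 2 <> 0.

Lemma zre_S k x y :
  zre (S k) x y = x / (x ^ 2 + y ^ 2) * zre k x y + y / (x ^ 2 + y ^ 2) * zim k x y.
Proof. unfold zre, zim, zinv; simpl; unfold Rdiv; ring. Qed.

Lemma zim_S k x y :
  zim (S k) x y = x / (x ^ 2 + y ^ 2) * zim k x y - y / (x ^ 2 + y ^ 2) * zre k x y.
Proof. unfold zre, zim, zinv; simpl; unfold Rdiv; ring. Qed.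

(* [auto_derive] and evars leave equalities typed in [R_AbsRing]. *)
Ltac eqR := match goal with |- @eq _ ?a ?b => change (@eq R a b) end.

Lemma is_derive_mult2_plus (f g h k : R -> R) x f' g' h' k' :
  is_derive f x f' -> is_derive g x g' -> is_derive h x h' -> is_derive k x k' ->
  is_derive (fun z => f z * g z + h z * k z) x
    (f' * g x + f x * g' + (h' * k x + h x * k')).
Proof.
  rewrite !is_derive_Reals; intros Hf Hg Hh Hk.
  exact (derivable_pt_lim_plus _ _ _ _ _ (derivable_pt_lim_mult _ _ _ _ _ Hf Hg)
    (derivable_pt_lim_mult _ _ _ _ _ Hh Hk)).
Qed.

Lemma is_derive_mult2_minus (f g h k : R -> R) x f' g' h' k' :
  is_derive f x f' -> is_derive g x g' -> is_derive h x h' -> is_derive k x k' ->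
  is_derive (fun z => f z * g z - h z * k z) x
    (f' * g x + f x * g' - (h' * k x + h x * k')).
Proof.
  rewrite !is_derive_Reals; intros Hf Hg Hh Hk.
  exact (derivable_pt_lim_minus _ _ _ _ _ (derivable_pt_lim_mult _ _ _ _ _ Hf Hg)
    (derivable_pt_lim_mult _ _ _ _ _ Hh Hk)).
Qed.

Lemma is_derive_eq (f : R -> R) x l l' : is_derive f x l -> l = l' -> is_derive f x l'.
Proof. now intros H <-. Qed.

Lemma is_derive_Rmult (f g : R -> R) x f' g' :
  is_derive f x f' -> is_derive g x g' ->
  is_derive (fun z => f z * g z) x (f' * g x + f x * g').
Proof. rewrite !is_derive_Reals; apply derivable_pt_lim_mult. Qed.

Lemma is_derive_Rplus (f g : R -> R) x f' g' :
  is_derive f x f' -> is_derive g x g' -> is_derive (fun z => f z + g z) x (f' + g').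
Proof. rewrite !is_derive_Reals; apply derivable_pt_lim_plus. Qed.

Lemma is_derive_Rminus (f g : R -> R) x f' g' :
  is_derive f x f' -> is_derive g x g' -> is_derive (fun z => f z - g z) x (f' - g').
Proof. rewrite !is_derive_Reals; apply derivable_pt_lim_minus. Qed.

Lemma is_derive_inj (f : R -> R) x l l' : is_derive f x l -> is_derive f x l' -> l = l'.
Proof.
  rewrite !is_derive_Reals; intros H1 H2; exact (uniqueness_limite f x l l' H1 H2).
Qed.

(** Real form of the complex derivative [- k w^(-(k+1))]. The derivative in [y] carries an extra
    factor [i], which exchanges the two parts. *)
Lemma zinv_derive_x k x y : punctured x y ->
  is_derive (fun z => zre k z y) x (- INR k * zre (S k) x y) /\
  is_derive (fun z => zim k z y) x (- INR k * zim (S k) x y).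
Proof.
  intros Hp; unfold punctured in Hp; induction k as [|k [IH1 IH2]].
  - split;
      [refine (is_derive_eq _ _ _ _ (is_derive_const 1 _) _)
      |refine (is_derive_eq _ _ _ _ (is_derive_const 0 _) _)];
      unfold zero; simpl; ring.
  - split;
      [apply (is_derive_ext (fun z => z / (z ^ 2 + y ^ 2) * zre k z y
              + y / (z ^ 2 + y ^ 2) * zim k z y)); [intros t; symmetry; apply zre_S|];
       eapply is_derive_eq; [apply is_derive_mult2_plus;
         [auto_derive; [exact Hp|reflexivity]|exact IH1
         |auto_derive; [exact Hp|reflexivity]|exact IH2]|]
      |apply (is_derive_ext (fun z => z / (z ^ 2 + y ^ 2) * zim k z y
              - y / (z ^ 2 + y ^ 2) * zre k z y)); [intros t; symmetry; apply zim_S|];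
       eapply is_derive_eq; [apply is_derive_mult2_minus;
         [auto_derive; [exact Hp|reflexivity]|exact IH2
         |auto_derive; [exact Hp|reflexivity]|exact IH1]|]];
    rewrite ?S_INR, !zre_S, !zim_S, ?zre_S, ?zim_S; eqR; field; exact Hp.
Qed.

Lemma zinv_derive_y k x y : punctured x y ->
  is_derive (fun z => zre k x z) y (INR k * zim (S k) x y) /\
  is_derive (fun z => zim k x z) y (- INR k * zre (S k) x y).
Proof.
  intros Hp; unfold punctured in Hp; induction k as [|k [IH1 IH2]].
  - split;
      [refine (is_derive_eq _ _ _ _ (is_derive_const 1 _) _)
      |refine (is_derive_eq _ _ _ _ (is_derive_const 0 _) _)];
      unfold zero; simpl; ring.
  - split;
      [apply (is_derive_ext (fun z => x / (x ^ 2 + z ^ 2) * zre k x z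
              + z / (x ^ 2 + z ^ 2) * zim k x z)); [intros t; symmetry; apply zre_S|];
       eapply is_derive_eq; [apply is_derive_mult2_plus;
         [auto_derive; [exact Hp|reflexivity]|exact IH1
         |auto_derive; [exact Hp|reflexivity]|exact IH2]|]
      |apply (is_derive_ext (fun z => x / (x ^ 2 + z ^ 2) * zim k x z
              - z / (x ^ 2 + z ^ 2) * zre k x z)); [intros t; symmetry; apply zim_S|];
       eapply is_derive_eq; [apply is_derive_mult2_minus;
         [auto_derive; [exact Hp|reflexivity]|exact IH2
         |auto_derive; [exact Hp|reflexivity]|exact IH1]|]];
    rewrite ?S_INR, !zre_S, !zim_S, ?zre_S, ?zim_S; eqR; field; exact Hp.
Qed.

Lemma continuity_2d_pt_div (f g : R -> R -> R) x y :
  continuity_2d_pt f x y -> continuity_2d_pt g x y -> g x y <> 0 ->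
  continuity_2d_pt (fun u v => f u v / g u v) x y.
Proof.
  intros Hf Hg H; apply (continuity_2d_pt_mult f (fun u v => / g u v)); [exact Hf|].
  now apply continuity_2d_pt_inv.
Qed.

Lemma continuity_2d_pt_pow (f : R -> R -> R) n x y :
  continuity_2d_pt f x y -> continuity_2d_pt (fun u v => f u v ^ n) x y.
Proof.
  intros Hf; induction n as [|n IH]; simpl.
  - apply continuity_2d_pt_const.
  - now apply continuity_2d_pt_mult.
Qed.

Ltac cont2d :=
  repeat (first [ assumption
    | apply continuity_2d_pt_const
    | apply continuity_2d_pt_id1
    | apply continuity_2d_pt_id2
    | apply continuity_2d_pt_pow
    | apply continuity_2d_pt_div
    | apply continuity_2d_pt_minus
    | apply continuity_2d_pt_plus
    | apply continuity_2d_pt_opp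
    | apply continuity_2d_pt_mult ]).

Lemma zinv_continuity k x y : punctured x y ->
  continuity_2d_pt (zre k) x y /\ continuity_2d_pt (zim k) x y.
Proof.
  intros Hp; unfold punctured in Hp; induction k as [|k [IH1 IH2]].
  - split; [exact (continuity_2d_pt_const x y 1)|exact (continuity_2d_pt_const x y 0)].
  - split;
    [apply (continuity_2d_pt_ext (fun u v => u / (u ^ 2 + v ^ 2) * zre k u v
              + v / (u ^ 2 + v ^ 2) * zim k u v)); [intros u v; symmetry; apply zre_S|]
    |apply (continuity_2d_pt_ext (fun u v => u / (u ^ 2 + v ^ 2) * zim k u v
              - v / (u ^ 2 + v ^ 2) * zre k u v)); [intros u v; symmetry; apply zim_S|]];
    cont2d.
Qed.

Lemma zinv_polar k r t : r <> 0 ->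
  zre k (r * cos t) (r * sin t) = / r ^ k * cos (INR k * t) /\
  zim k (r * cos t) (r * sin t) = - (/ r ^ k * sin (INR k * t)).
Proof.
  intros Hr; induction k as [|k [IH1 IH2]].
  - unfold zre, zim, zinv; simpl; rewrite Rmult_0_l, cos_0, sin_0; lra.
  - assert (Hs : (r * cos t) ^ 2 + (r * sin t) ^ 2 = r ^ 2).
    { generalize (sin2_cos2 t); unfold Rsqr; intros E.
      transitivity (r ^ 2 * (sin t * sin t + cos t * cos t)); [ring|rewrite E; ring]. }
    rewrite zre_S, zim_S, IH1, IH2, Hs, S_INR.
    replace ((INR k + 1) * t) with (INR k * t + t) by ring.
    rewrite cos_plus, sin_plus; simpl.
    split; field; split; try assumption; now apply pow_nonzero.
Qed.

(** * Branches of the root and the curl condition *)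

Lemma continuous_pair_2d (f g : R -> R -> R) (x y : R) :
  continuity_2d_pt f x y -> continuity_2d_pt g x y ->
  continuous (fun z : C => (f (fst z) (snd z), g (fst z) (snd z)) : C) (x, y).
Proof.
  rewrite !continuity_2d_pt_filterlim; intros Hf Hg.
  intros P [eps HP].
  assert (A := Hf _ (locally_ball (f x y) eps)).
  assert (B := Hg _ (locally_ball (g x y) eps)).
  unfold filtermap in A, B.
  change (locally (x, y) (fun z : R * R => P (f (fst z) (snd z), g (fst z) (snd z)))).
  generalize (filter_and _ _ A B); apply filter_imp.
  intros z [Ha Hb]; apply HP; split; assumption.
Qed.

Lemma polar_pow r t n : (polar r t ^ n)%C = polar (r ^ n) (INR n * t).
Proof.
  induction n as [|n IH].
  - unfold polar, expi; simpl; rewrite Rmult_0_l, cos_0, sin_0.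
    apply injective_projections; simpl; ring.
  - rewrite Cpow_S, IH, S_INR.
    replace ((INR n + 1) * t) with (INR n * t + t) by ring.
    unfold polar, expi; rewrite cos_plus, sin_plus.
    apply injective_projections; simpl; ring.
Qed.

(* Real coordinates of [xi + i eta |-> (xi + i eta) ^ (1/n)] on [xi > 0]. *)
Definition root_modulus (n xi eta : R) : R := exp (ln (xi ^ 2 + eta ^ 2) / (2 * n)).
Definition root_angle (n xi eta : R) : R := atan (eta / xi) / n.

Lemma root_pow (d : nat) (xi eta : R) : (1 <= d)%nat -> 0 < xi ->
  (polar (root_modulus (INR d) xi eta) (root_angle (INR d) xi eta) ^ d)%C = (xi, eta).
Proof.
  intros Hd Hxi.
  assert (Hd' : INR d <> 0) by (apply not_0_INR; lia).
  assert (Hm : 0 < xi ^ 2 + eta ^ 2) by nra.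
  rewrite polar_pow.
  replace (INR d * root_angle (INR d) xi eta) with (atan (eta / xi))
    by (unfold root_angle; field; exact Hd').
  replace (root_modulus (INR d) xi eta ^ d) with (sqrt (xi ^ 2 + eta ^ 2)).
  2: { unfold root_modulus; rewrite <- (Rpower_pow d) by apply exp_pos.
       unfold Rpower; rewrite ln_exp.
       replace (INR d * _) with (/ 2 * ln (xi ^ 2 + eta ^ 2)) by (field; exact Hd').
       symmetry; apply (Rpower_sqrt _ Hm). }
  replace (xi ^ 2 + eta ^ 2) with (xi ^ 2 * (1 + (eta / xi)²))
    by (unfold Rsqr; field; lra).
  assert (H1 : 0 < 1 + (eta / xi)²) by (generalize (Rle_0_sqr (eta / xi)); lra).
  rewrite sqrt_mult_alt by nra.
  rewrite sqrt_pow2 by lra.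
  unfold polar, expi; rewrite cos_atan, sin_atan.
  generalize (sqrt_lt_R0 _ H1); intros H2.
  apply injective_projections; simpl; field; lra.
Qed.

(** The principal root has complex derivative [1/n] at [1]. The base point [1] suffices because the
    branch through [w] is normalised by dividing [z] by [w^d]. *)
Lemma is_derive_root (n : R) (X Y : R -> R) (s X' Y' : R) : n <> 0 ->
  X s = 1 -> Y s = 0 -> is_derive X s X' -> is_derive Y s Y' ->
  is_derive (fun t => root_modulus n (X t) (Y t) * cos (root_angle n (X t) (Y t)))
    s (X' / n) /\
  is_derive (fun t => root_modulus n (X t) (Y t) * sin (root_angle n (X t) (Y t)))
    s (Y' / n).
Proof.
  intros Hn HX HY DX DY; unfold root_modulus, root_angle.
  assert (EX : Derive (fun x => X x) s = X') by now apply is_derive_unique.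
  assert (EY : Derive (fun x => Y x) s = Y') by now apply is_derive_unique.
  split; auto_derive; rewrite ?HX, ?HY;
    try (repeat split; first [now exists X' | now exists Y' | lra]);
    rewrite EX, EY;
    replace (1 * (1 * 1) + 0 * (0 * 1)) with 1 by ring;
    replace (0 / 1) with 0 by field;
    replace (0 * / 1) with 0 by field;
    rewrite ?ln_1, ?atan_0; unfold Rdiv; rewrite ?Rmult_0_l, ?exp_0, ?cos_0, ?sin_0;
    field; lra.
Qed.

Lemma locally_2d_lt (f g : R -> R -> R) (x y : R) :
  continuity_2d_pt f x y -> continuity_2d_pt g x y -> f x y < g x y ->
  locally_2d (fun u v => f u v < g u v) x y.
Proof.
  intros Hf Hg H.
  assert (He : 0 < (g x y - f x y) / 2) by lra.
  generalize (locally_2d_and _ _ _ _ (Hf (mkposreal _ He)) (Hg (mkposreal _ He))).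
  apply locally_2d_impl, locally_2d_forall; simpl.
  intros u v [H1 H2]; apply Rabs_def2 in H1; apply Rabs_def2 in H2; lra.
Qed.

Lemma Cmod_pair x y : Cmod (x, y) = sqrt (x ^ 2 + y ^ 2).
Proof. reflexivity. Qed.

Lemma Cmod_continuity x y : continuity_2d_pt (fun a b => Cmod (a, b)) x y.
Proof.
  apply (continuity_1d_2d_pt_comp sqrt (fun a b => a ^ 2 + b ^ 2)).
  - apply continuity_pt_sqrt; nra.
  - cont2d.
Qed.

Lemma open_disk_2d rad : open_2d (fun x y => disk rad (x, y)).
Proof.
  intros x y H; apply (locally_2d_lt (fun a b => Cmod (a, b)) (fun _ _ => rad));
    [apply Cmod_continuity|apply continuity_2d_pt_const|exact H].
Qed.

(** Twice the [z]-derivative of [v] is [div v + i curl v]. For a holomorphic branch it equals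
    [2 u_w] times [w^(-k) / d], so the curl condition kills the imaginary part of [2 u_w w^(-k)].
    The work lies in exhibiting a branch through each point [w = (x, y)] other than the origin. *)
Lemma curl_free_relation (rad : R) (k : nat) (u : C -> C) (x y : R) :
  root_pullback_curl_free rad (S k) u ->
  (forall a b, disk rad (a, b) -> C2_at u (a, b)) ->
  disk rad (x, y) -> punctured x y ->
  zre k x y * (dx (comp2 u) x y - dy (comp1 u) x y)
  + zim k x y * (dy (comp2 u) x y + dx (comp1 u) x y) = 0.
Proof.
  intros Hcurl HC2 Hdisk Hp.
  assert (Hw : ((x, y) : C) <> 0%C).
  { intros E; apply Hp; injection E; intros -> ->; ring. }
  assert (Hz0 : ((x, y) ^ S k)%C <> 0%C) by now apply Cpow_nz.
  destruct ((x, y) ^ S k)%C as [x0 y0] eqn:Ez0.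
  destruct (Cinv (x0, y0)) as [al be] eqn:Ez.
  set (n := INR (S k)).
  assert (Hn : n <> 0) by (apply not_0_INR; lia).
  (* [X] and [Y] are the coordinates of [z / w^d] with [d = S k]. The branch is
     [g z = w (z / w^d)^(1/d)], with the principal root on the half-plane [X > 0]; it sends [w^d] to
     [w]. *)
  set (X := fun a b : R => a * al - b * be).
  set (Y := fun a b : R => a * be + b * al).
  set (P1 := fun a b => root_modulus n (X a b) (Y a b) * cos (root_angle n (X a b) (Y a b))).
  set (P2 := fun a b => root_modulus n (X a b) (Y a b) * sin (root_angle n (X a b) (Y a b))).
  set (g1 := fun a b => x * P1 a b - y * P2 a b).
  set (g2 := fun a b => x * P2 a b + y * P1 a b).
  set (g := fun z : C => (g1 (fst z) (snd z), g2 (fst z) (snd z)) : C).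
  set (U := fun z : C => 0 < X (fst z) (snd z) /\ disk (rad ^ S k) z).
  assert (EXY : forall a b : R, ((a, b) * / (x0, y0))%C = (X a b, Y a b)).
  { intros a b; rewrite Ez; reflexivity. }
  assert (CX : forall a b, continuity_2d_pt X a b) by (intros a b; unfold X; cont2d).
  assert (CY : forall a b, continuity_2d_pt Y a b) by (intros a b; unfold Y; cont2d).
  assert (Hb : root_branch (S k) U g).
  { split; [|split].
    - intros [a b] [H1 H2].
      apply (proj1 (locally_2d_locally
        (fun a b => 0 < X a b /\ disk (rad ^ S k) (a, b)) a b)).
      apply locally_2d_and; [|exact (open_disk_2d _ _ _ H2)].
      apply locally_2d_lt; [apply continuity_2d_pt_const|apply CX|exact H1].
    - intros [a b] [H1 _]; simpl in H1.
      assert (CM : continuity_2d_pt (fun a b => root_modulus n (X a b) (Y a b)) a b).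
      { apply (continuity_1d_2d_pt_comp exp).
        { apply derivable_continuous, derivable_exp. }
        apply continuity_2d_pt_mult; [|apply continuity_2d_pt_const].
        apply (continuity_1d_2d_pt_comp ln).
        { apply derivable_continuous_pt; exists (/ (X a b ^ 2 + Y a b ^ 2)).
          apply derivable_pt_lim_ln; nra. }
        cont2d; auto. }
      assert (CA : continuity_2d_pt (fun a b => root_angle n (X a b) (Y a b)) a b).
      { apply continuity_2d_pt_mult; [|apply continuity_2d_pt_const].
        apply (continuity_1d_2d_pt_comp atan).
        { apply derivable_continuous_pt, derivable_pt_atan. }
        apply continuity_2d_pt_div; auto; lra. }
      assert (CP1 : continuity_2d_pt P1 a b).
      { apply continuity_2d_pt_mult; [exact CM|].
        apply (continuity_1d_2d_pt_comp cos); [|exact CA].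
        apply derivable_continuous, derivable_cos. }
      assert (CP2 : continuity_2d_pt P2 a b).
      { apply continuity_2d_pt_mult; [exact CM|].
        apply (continuity_1d_2d_pt_comp sin); [|exact CA].
        apply derivable_continuous, derivable_sin. }
      apply continuous_pair_2d; unfold g1, g2; cont2d.
    - intros [a b] [H1 _].
      assert (Eg : g (a, b) = ((x, y) * polar (root_modulus n (X a b) (Y a b))
                                (root_angle n (X a b) (Y a b)))%C).
      { unfold g, g1, g2, P1, P2, polar, expi.
        apply injective_projections; simpl; ring. }
      rewrite Eg, Cpow_mult_l, Ez0; unfold n.
      rewrite root_pow; [|lia|exact H1].
      rewrite <- EXY; field; exact Hz0. }
  assert (HU : forall z, U z -> disk (rad ^ S k) z) by now intros z [_ H].
  assert (E1 : ((X x0 y0, Y x0 y0) : C) = RtoC 1).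
  { rewrite <- (EXY x0 y0). now apply Cinv_r. }
  injection E1; intros EY EX.
  assert (Uz : U (x0, y0)).
  { split; [simpl; rewrite EX; lra|].
    unfold disk; rewrite <- Ez0, Cmod_pow.
    generalize (Cmod_ge_0 (x, y)); unfold disk in Hdisk; intros H0.
    assert (H1 := pow_incr (Cmod (x, y)) rad k).
    assert (H2 := pow_lt rad k).
    simpl; nra. }
  assert (Eg0 : g1 x0 y0 = x /\ g2 x0 y0 = y).
  { unfold g1, g2, P1, P2, root_modulus, root_angle; rewrite EX, EY.
    replace (1 ^ 2 + 0 ^ 2) with 1 by ring.
    replace (0 / 1) with 0 by field.
    rewrite ln_1, atan_0; unfold Rdiv; rewrite !Rmult_0_l, exp_0, cos_0, sin_0.
    split; ring. }
  destruct Eg0 as [Eg1 Eg2].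
  assert (Hc := Hcurl U g Hb HU (x0, y0) Uz).
  assert (Hd1 : forall a b, disk rad (a, b) -> ex_diff_n (comp1 u) 1 a b).
  { intros a b H; apply (ex_diff_n_m 2 1); [lia|apply (HC2 a b H)]. }
  assert (Hd2 : forall a b, disk rad (a, b) -> ex_diff_n (comp2 u) 1 a b).
  { intros a b H; apply (ex_diff_n_m 2 1); [lia|apply (HC2 a b H)]. }
  assert (DXx : is_derive (fun t => X t y0) x0 al).
  { unfold X; auto_derive; [exact I|ring]. }
  assert (DYx : is_derive (fun t => Y t y0) x0 be).
  { unfold Y; auto_derive; [exact I|ring]. }
  assert (DXy : is_derive (fun t => X x0 t) y0 (- be)).
  { unfold X; auto_derive; [exact I|ring]. }
  assert (DYy : is_derive (fun t => Y x0 t) y0 al).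
  { unfold Y; auto_derive; [exact I|ring]. }
  destruct (is_derive_root n (fun t => X t y0) (fun t => Y t y0) x0 al be
    Hn EX EY DXx DYx) as [DP1x DP2x].
  destruct (is_derive_root n (fun t => X x0 t) (fun t => Y x0 t) y0 (- be) al
    Hn EX EY DXy DYy) as [DP1y DP2y].
  assert (K : forall (P Q : R -> R) s P' Q' c e, is_derive P s P' -> is_derive Q s Q' ->
    is_derive (fun t => c * P t + e * Q t) s (c * P' + e * Q')).
  { intros P Q s P' Q' c e HP HQ.
    apply @is_derive_plus; now apply is_derive_scal. }
  assert (Dg1x : is_derive (fun t => g1 t y0) x0 (x * (al / n) + - y * (be / n))).
  { apply (is_derive_ext (fun t => x * P1 t y0 + - y * P2 t y0));
      [intros t; unfold g1; eqR; ring|now apply K]. }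
  assert (Dg2x : is_derive (fun t => g2 t y0) x0 (x * (be / n) + y * (al / n))).
  { now apply K. }
  assert (Dg1y : is_derive (fun t => g1 x0 t) y0 (x * (- be / n) + - y * (al / n))).
  { apply (is_derive_ext (fun t => x * P1 x0 t + - y * P2 x0 t));
      [intros t; unfold g1; eqR; ring|now apply K]. }
  assert (Dg2y : is_derive (fun t => g2 x0 t) y0 (x * (al / n) + y * (- be / n))).
  { now apply K. }
  assert (Og : disk rad (g1 x0 y0, g2 x0 y0)) by (rewrite Eg1, Eg2; exact Hdisk).
  assert (Q1 := chain_2d _ (comp2 u) (fun t => g1 t y0) (fun t => g2 t y0) x0 _ _
    (open_disk_2d rad) Hd2 Og Dg1x Dg2x).
  assert (Q2 := chain_2d _ (comp1 u) (fun t => g1 x0 t) (fun t => g2 x0 t) y0 _ _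
    (open_disk_2d rad) Hd1 Og Dg1y Dg2y).
  cbv beta in Q1, Q2; rewrite Eg1, Eg2 in Q1, Q2.
  assert (Hc' := f_equal2 Rminus (is_derive_unique _ _ _ Q1) (is_derive_unique _ _ _ Q2)).
  apply (eq_trans (eq_sym Hc')) in Hc; clear Hc'.
  (* The derivative of [g] at [w^d] is [w w^(-d) / d = w^(-k) / d]; the factor [1/d] is cancelled
     afterwards. *)
  assert (EK : ((x, y) * (al, be))%C = zinv k x y).
  { rewrite <- Ez, <- Ez0; unfold zinv; rewrite Cpow_S, Cpow_inv by exact Hw.
    field; split; [now apply Cpow_nz|exact Hw]. }
  unfold zre, zim; rewrite <- EK; simpl.
  apply (Rmult_eq_reg_r (/ n)); [|now apply Rinv_neq_0_compat].
  rewrite Rmult_0_l, <- Hc; unfold Rdiv; ring.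
Qed.

(** * The first-order system in polar coordinates *)

Lemma ex_diff_2_derivs (f : R -> R -> R) x y : ex_diff_n f 2 x y ->
  (is_derive (fun z => f z y) x (dx f x y) /\ is_derive (fun z => f x z) y (dy f x y)) /\
  (is_derive (fun z => dx f z y) x (dx (dx f) x y) /\
   is_derive (fun z => dx f x z) y (dy (dx f) x y)) /\
  (is_derive (fun z => dy f z y) x (dx (dy f) x y) /\
   is_derive (fun z => dy f x z) y (dy (dy f) x y)).
Proof.
  intros (_ & H1 & H2 & (_ & H3 & H4 & _) & (_ & H5 & H6 & _)).
  repeat split; now apply Derive_correct.
Qed.

Lemma ex_diff_2_continuous (f : R -> R -> R) x y : ex_diff_n f 2 x y ->
  continuity_2d_pt f x y /\ continuity_2d_pt (dx f) x y /\ continuity_2d_pt (dy f) x y /\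
  continuity_2d_pt (dy (dx f)) x y /\ continuity_2d_pt (dx (dy f)) x y.
Proof.
  intros (H1 & _ & _ & (H2 & _ & _ & _ & H3 & _) & (H4 & _ & _ & (H5 & _) & _)).
  repeat split; assumption.
Qed.

Lemma mixed_derivatives (O : R -> R -> Prop) (f : R -> R -> R) :
  open_2d O -> (forall x y, O x y -> ex_diff_n f 2 x y) ->
  forall x y, O x y -> dy (dx f) x y = dx (dy f) x y.
Proof.
  intros HO Hf; apply (schwarz_open O f (dx f) (dy f)); try assumption;
    intros x y Oxy; first [apply (ex_diff_2_derivs f x y); auto
                          |apply (ex_diff_2_continuous f x y); auto].
Qed.

(* With [gamma = w^(-k)], the curl condition says that [Im (2 u_w gamma) = 0], so
   [D = Re (2 u_w gamma)] has gradient [gamma * laplacian u]; the conclusion is the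
   symmetry of the second derivatives of [D]. *)
Lemma second_order_relation (O : R -> R -> Prop) (k : nat) (p q : R -> R -> R) :
  open_2d O -> (forall x y, O x y -> punctured x y) ->
  (forall x y, O x y -> ex_diff_n p 2 x y) ->
  (forall x y, O x y -> ex_diff_n q 2 x y) ->
  (forall x y, O x y -> dx (dx p) x y + dy (dy p) x y
     = (p x y * p x y + q x y * q x y - 1) * p x y) ->
  (forall x y, O x y -> dx (dx q) x y + dy (dy q) x y
     = (p x y * p x y + q x y * q x y - 1) * q x y) ->
  (forall x y, O x y -> zre k x y * (dx q x y - dy p x y)
     + zim k x y * (dy q x y + dx p x y) = 0) ->
  forall x y, O x y ->
  2 * (p x y * dy p x y + q x y * dy q x y) * (zre k x y * p x y - zim k x y * q x y)
  - 2 * (p x y * dx p x y + q x y * dx q x y) * (zre k x y * q x y + zim k x y * p x y)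
  + 2 * INR k * (p x y * p x y + q x y * q x y - 1)
    * (zim (S k) x y * p x y + zre (S k) x y * q x y) = 0.
Proof.
  intros HO Hpun Hp Hq Lp Lq HE x y Oxy.
  set (N1 := fun x y => p x y * p x y + q x y * q x y - 1).
  assert (H : forall x y, O x y ->
    (dy p x y * p x y + p x y * dy p x y + (dy q x y * q x y + q x y * dy q x y) - 0)
      * (zre k x y * p x y - zim k x y * q x y)
    + N1 x y * (INR k * zim (S k) x y * p x y + zre k x y * dy p x y
      - (- INR k * zre (S k) x y * q x y + zim k x y * dy q x y)) =
    (dx p x y * p x y + p x y * dx p x y + (dx q x y * q x y + q x y * dx q x y) - 0)
      * (zre k x y * q x y + zim k x y * p x y)
    + N1 x y * (- INR k * zre (S k) x y * q x y + zre k x y * dx q x y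
      + (- INR k * zim (S k) x y * p x y + zim k x y * dx p x y))).
  2: { generalize (H x y Oxy) (HE x y Oxy); unfold N1; intros H1 H2; nra. }
  clear x y Oxy.
  apply (schwarz_open O
    (fun x y => zre k x y * (dx p x y + dy q x y) - zim k x y * (dx q x y - dy p x y))
    (fun x y => N1 x y * (zre k x y * p x y - zim k x y * q x y))
    (fun x y => N1 x y * (zre k x y * q x y + zim k x y * p x y))); trivial;
    intros x y Oxy;
    destruct (zinv_derive_x k x y (Hpun x y Oxy)) as [Za Zb];
    destruct (zinv_derive_y k x y (Hpun x y Oxy)) as [Zc Zd];
    destruct (ex_diff_2_derivs p x y (Hp x y Oxy)) as ((P1 & P2) & (P3 & P4) & (P5 & P6));
    destruct (ex_diff_2_derivs q x y (Hq x y Oxy)) as ((Q1 & Q2) & (Q3 & Q4) & (Q5 & Q6));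
    assert (Mp := mixed_derivatives O p HO Hp x y Oxy);
    assert (Mq := mixed_derivatives O q HO Hq x y Oxy).
  - refine (is_derive_eq _ _ _ _ (is_derive_mult2_minus _ _ _ _ _ _ _ _ _
      Za (is_derive_Rplus _ _ _ _ _ P3 Q5) Zb (is_derive_Rminus _ _ _ _ _ Q3 P5)) _).
    (* The [y]-derivative of the curl relation. Subtracted from [D_x], it leaves only the Laplacians
       of [p] and [q]: the first-order terms cancel by the Cauchy-Riemann equations for [w^(-k)].
       For [D_y] below, the [x]-derivative is added instead. *)
    assert (E : INR k * zim (S k) x y * (dx q x y - dy p x y)
      + zre k x y * (dy (dx q) x y - dy (dy p) x y)
      + (- INR k * zre (S k) x y * (dy q x y + dx p x y)
         + zim k x y * (dy (dy q) x y + dy (dx p) x y)) = 0).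
    { rewrite <- (is_derive_unique _ _ _ (is_derive_mult2_plus _ _ _ _ _ _ _ _ _
        Zc (is_derive_Rminus _ _ _ _ _ Q4 P6) Zd (is_derive_Rplus _ _ _ _ _ Q6 P4))).
      rewrite <- (Derive_const 0 y); apply Derive_ext_loc.
      generalize (locally_2d_1d_const_x _ _ _ (HO x y Oxy)).
      apply filter_imp; intros t Ht; now apply HE. }
    generalize (Lp x y Oxy) (Lq x y Oxy); intros EP EQ.
    unfold N1; rewrite Mp, Mq in E.
    replace (dx (dx p) x y) with ((p x y * p x y + q x y * q x y - 1) * p x y - dy (dy p) x y)
      by (rewrite <- EP; ring).
    replace (dx (dx q) x y) with ((p x y * p x y + q x y * q x y - 1) * q x y - dy (dy q) x y)
      by (rewrite <- EQ; ring).
    nra.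
  - refine (is_derive_eq _ _ _ _ (is_derive_mult2_minus _ _ _ _ _ _ _ _ _
      Zc (is_derive_Rplus _ _ _ _ _ P4 Q6) Zd (is_derive_Rminus _ _ _ _ _ Q4 P6)) _).
    assert (E : - INR k * zre (S k) x y * (dx q x y - dy p x y)
      + zre k x y * (dx (dx q) x y - dx (dy p) x y)
      + (- INR k * zim (S k) x y * (dy q x y + dx p x y)
         + zim k x y * (dx (dy q) x y + dx (dx p) x y)) = 0).
    { rewrite <- (is_derive_unique _ _ _ (is_derive_mult2_plus _ _ _ _ _ _ _ _ _
        Za (is_derive_Rminus _ _ _ _ _ Q3 P5) Zb (is_derive_Rplus _ _ _ _ _ Q5 P3))).
      rewrite <- (Derive_const 0 x); apply Derive_ext_loc.
      generalize (locally_2d_1d_const_y _ _ _ (HO x y Oxy)).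
      apply filter_imp; intros t Ht; now apply HE. }
    generalize (Lp x y Oxy) (Lq x y Oxy); intros EP EQ.
    unfold N1; rewrite Mp, Mq.
    replace (dy (dy p) x y) with ((p x y * p x y + q x y * q x y - 1) * p x y - dx (dx p) x y)
      by (rewrite <- EP; ring).
    replace (dy (dy q) x y) with ((p x y * p x y + q x y * q x y - 1) * q x y - dx (dx q) x y)
      by (rewrite <- EQ; ring).
    nra.
  - exact (is_derive_Rmult _ _ _ _ _
      (is_derive_Rminus _ _ _ _ _ (is_derive_mult2_plus _ _ _ _ _ _ _ _ _ P2 P2 Q2 Q2)
        (is_derive_const 1 _))
      (is_derive_mult2_minus _ _ _ _ _ _ _ _ _ Zc P2 Zd Q2)).
  - exact (is_derive_Rmult _ _ _ _ _
      (is_derive_Rminus _ _ _ _ _ (is_derive_mult2_plus _ _ _ _ _ _ _ _ _ P1 P1 Q1 Q1)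
        (is_derive_const 1 _))
      (is_derive_mult2_plus _ _ _ _ _ _ _ _ _ Za Q1 Zb P1)).
  - destruct (ex_diff_2_continuous p x y (Hp x y Oxy)) as (? & ? & ? & _).
    destruct (ex_diff_2_continuous q x y (Hq x y Oxy)) as (? & ? & ? & _).
    destruct (zinv_continuity k x y (Hpun x y Oxy)).
    destruct (zinv_continuity (S k) x y (Hpun x y Oxy)).
    unfold N1; cont2d.
  - destruct (ex_diff_2_continuous p x y (Hp x y Oxy)) as (? & ? & ? & _).
    destruct (ex_diff_2_continuous q x y (Hq x y Oxy)) as (? & ? & ? & _).
    destruct (zinv_continuity k x y (Hpun x y Oxy)).
    destruct (zinv_continuity (S k) x y (Hpun x y Oxy)).
    unfold N1; cont2d.
Qed.

(* Components of [e^(-int) (p + iq)] at the point with polar coordinates [(r, t)]. *)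
Definition rot_re (n : R) (p q : R -> R -> R) (r t : R) : R :=
  p (r * cos t) (r * sin t) * cos (n * t) + q (r * cos t) (r * sin t) * sin (n * t).
Definition rot_im (n : R) (p q : R -> R -> R) (r t : R) : R :=
  q (r * cos t) (r * sin t) * cos (n * t) - p (r * cos t) (r * sin t) * sin (n * t).

(** In polar coordinates [u_w] contributes the phase [e^(-it)], [w^(-k)] contributes [e^(-ikt)], and
    [u] contributes [e^(int)]. They cancel because [n = k + 1], so the system for [a] and [b] has
    coefficients free of [t]. *)
Lemma polar_system (O : R -> R -> Prop) (k : nat) (p q : R -> R -> R) :
  open_2d O -> (forall x y, O x y -> punctured x y) ->
  (forall x y, O x y -> ex_diff_n p 2 x y) ->
  (forall x y, O x y -> ex_diff_n q 2 x y) ->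
  (forall x y, O x y -> dx (dx p) x y + dy (dy p) x y
     = (p x y * p x y + q x y * q x y - 1) * p x y) ->
  (forall x y, O x y -> dx (dx q) x y + dy (dy q) x y
     = (p x y * p x y + q x y * q x y - 1) * q x y) ->
  (forall x y, O x y -> zre k x y * (dx q x y - dy p x y)
     + zim k x y * (dy q x y + dx p x y) = 0) ->
  let a := rot_re (INR (S k)) p q in
  let b := rot_im (INR (S k)) p q in
  forall r t, r <> 0 -> O (r * cos t) (r * sin t) ->
  exists ar at_ br bt,
    is_derive (fun s => a s t) r ar /\ is_derive (fun s => a r s) t at_ /\
    is_derive (fun s => b s t) r br /\ is_derive (fun s => b r s) t bt /\
    r * br + INR (S k) * b r t = at_ /\
    a r t * (a r t * at_ + b r t * bt)
    = b r t * (r * (a r t * ar + b r t * br)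
               + INR k * (1 - a r t * a r t - b r t * b r t)).
Proof.
  intros HO Hpun Hp Hq Lp Lq HE a b r t Hr Ort.
  assert (H2 := second_order_relation O k p q HO Hpun Hp Hq Lp Lq HE _ _ Ort).
  assert (H1 := HE _ _ Ort).
  assert (Hp1 : forall x y, O x y -> ex_diff_n p 1 x y)
    by (intros; apply (ex_diff_n_m 2 1); auto).
  assert (Hq1 : forall x y, O x y -> ex_diff_n q 1 x y)
    by (intros; apply (ex_diff_n_m 2 1); auto).
  assert (DXr : is_derive (fun s => s * cos t) r (cos t)) by (auto_derive; trivial; ring).
  assert (DYr : is_derive (fun s => s * sin t) r (sin t)) by (auto_derive; trivial; ring).
  assert (DXt : is_derive (fun s => r * cos s) t (- r * sin t)) by (auto_derive; trivial; ring).
  assert (DYt : is_derive (fun s => r * sin s) t (r * cos t)) by (auto_derive; trivial; ring).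
  assert (Pr := chain_2d O p (fun s => s * cos t) (fun s => s * sin t) r _ _ HO Hp1 Ort DXr DYr).
  assert (Qr := chain_2d O q (fun s => s * cos t) (fun s => s * sin t) r _ _ HO Hq1 Ort DXr DYr).
  assert (Pt := chain_2d O p (fun s => r * cos s) (fun s => r * sin s) t _ _ HO Hp1 Ort DXt DYt).
  assert (Qt := chain_2d O q (fun s => r * cos s) (fun s => r * sin s) t _ _ HO Hq1 Ort DXt DYt).
  set (n := INR (S k)).
  assert (Cr : is_derive (fun _ => cos (n * t)) r 0) by exact (is_derive_const _ _).
  assert (Sr : is_derive (fun _ => sin (n * t)) r 0) by exact (is_derive_const _ _).
  assert (Ct : is_derive (fun s => cos (n * s)) t (- n * sin (n * t)))
    by (auto_derive; trivial; ring).
  assert (St : is_derive (fun s => sin (n * s)) t (n * cos (n * t)))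
    by (auto_derive; trivial; ring).
  do 4 eexists.
  split; [exact (is_derive_mult2_plus _ _ _ _ _ _ _ _ _ Pr Cr Qr Sr)|].
  split; [exact (is_derive_mult2_plus _ _ _ _ _ _ _ _ _ Pt Ct Qt St)|].
  split; [exact (is_derive_mult2_minus _ _ _ _ _ _ _ _ _ Qr Cr Pr Sr)|].
  split; [exact (is_derive_mult2_minus _ _ _ _ _ _ _ _ _ Qt Ct Pt St)|].
  destruct (zinv_polar k r t Hr) as [Z1 Z2].
  destruct (zinv_polar (S k) r t Hr) as [Z3 Z4].
  rewrite Z1, Z2 in H1; rewrite Z1, Z2, Z3, Z4 in H2.
  unfold a, b, rot_re, rot_im; fold n; fold n in H2.
  replace (INR k * t) with (n * t - t) in H1, H2 by (unfold n; rewrite S_INR; ring).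
  rewrite cos_minus, sin_minus in H1, H2.
  generalize (sin2_cos2 t) (sin2_cos2 (n * t)); unfold Rsqr; intros T1 T2.
  assert (Hk : r ^ k <> 0) by now apply pow_nonzero.
  assert (En : INR k = n - 1) by (unfold n; rewrite S_INR; ring).
  rewrite En in *; clear En Z1 Z2 Z3 Z4 Pr Qr Pt Qt Cr Sr Ct St DXr DYr DXt DYt.
  simpl pow in H2.
  set (P := p (r * cos t) (r * sin t)) in *; set (Q := q (r * cos t) (r * sin t)) in *.
  set (px := dx p (r * cos t) (r * sin t)) in *; set (qx := dx q (r * cos t) (r * sin t)) in *.
  set (py := dy p (r * cos t) (r * sin t)) in *; set (qy := dy q (r * cos t) (r * sin t)) in *.
  set (c := cos t) in *; set (s := sin t) in *.
  set (cn := cos (n * t)) in *; set (sn := sin (n * t)) in *.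
  clearbody P Q px qx py qy c s cn sn n.
  assert (H1' : (cn * c + sn * s) * (qx - py) - (sn * c - cn * s) * (qy + px) = 0).
  { apply (Rmult_eq_reg_l (/ r ^ k)); [|now apply Rinv_neq_0_compat].
    rewrite Rmult_0_r, <- H1; ring. }
  assert (H2' : r * ((P * py + Q * qy) * ((cn * c + sn * s) * P + (sn * c - cn * s) * Q)
    - (P * px + Q * qx) * ((cn * c + sn * s) * Q - (sn * c - cn * s) * P))
    + (n - 1) * (P * P + Q * Q - 1) * (cn * Q - sn * P) = 0).
  { apply (Rmult_eq_reg_l (2 * / (r * r ^ k)));
      [|apply Rmult_integral_contrapositive_currified;
        [lra|now apply Rinv_neq_0_compat, Rmult_integral_contrapositive_currified]].
    rewrite Rmult_0_r, <- H2; field; split; assumption. }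
  split.
  - apply Rminus_diag_uniq.
    transitivity (r * ((cn * c + sn * s) * (qx - py) - (sn * c - cn * s) * (qy + px)));
      [ring|rewrite H1'; ring].
  - apply Rminus_diag_uniq.
    set (A := P * cn + Q * sn); set (B := Q * cn - P * sn).
    assert (EN : A * A + B * B = P * P + Q * Q).
    { transitivity ((P * P + Q * Q) * (sn * sn + cn * cn)); [unfold A, B; ring|rewrite T2; ring]. }
    (* The factor [sn * sn + cn * cn], equal to 1, is inserted where the rotation by [n * t] is
       undone, so that the first equality becomes a polynomial identity. *)
    transitivity (A * ((sn * sn + cn * cn) * (r * (P * (c * py - s * px) + Q * (c * qy - s * qx))))
      - B * (r * ((sn * sn + cn * cn) * (P * (c * px + s * py) + Q * (c * qx + s * qy)))
        + (n - 1) * (1 - (A * A + B * B)))); [unfold A, B; ring|].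
    rewrite T2, EN, <- H2'; unfold A, B; ring.
Qed.

(** * Vanishing of the angular component *)

(** For [a <= b] a 1-Lipschitz retraction onto [[a, b]]; composing with it turns a function
    controlled only on a segment into one continuous on the whole line. *)
Definition clamp (a b x : R) : R := Rmax a (Rmin x b).

Lemma clamp_bounds a b x : a <= b -> a <= clamp a b x <= b.
Proof.
  intros H; unfold clamp, Rmax, Rmin.
  destruct (Rle_dec x b); destruct (Rle_dec a _); lra.
Qed.

Lemma clamp_id a b x : a <= x <= b -> clamp a b x = x.
Proof.
  intros H; unfold clamp, Rmax, Rmin.
  destruct (Rle_dec x b); destruct (Rle_dec a _); lra.
Qed.

Lemma clamp_lipschitz a b x y : Rabs (clamp a b x - clamp a b y) <= Rabs (x - y).
Proof.
  unfold clamp, Rmax, Rmin.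
  destruct (Rle_dec x b), (Rle_dec y b);
    repeat match goal with |- context [Rle_dec ?u ?v] => destruct (Rle_dec u v) end;
    split_Rabs; lra.
Qed.

Lemma continuity_pt_eps (f : R -> R) (x : R) :
  (forall eps, 0 < eps -> exists delta, 0 < delta /\
     forall y, Rabs (y - x) < delta -> Rabs (f y - f x) < eps) ->
  continuity_pt f x.
Proof.
  intros H eps He; destruct (H eps He) as [delta [Hd H']].
  exists delta; split; [exact Hd|].
  intros y [_ Hy]; exact (H' y Hy).
Qed.

Lemma continuity_2d_pt_section (f : R -> R -> R) x y :
  continuity_2d_pt f x y -> continuity_pt (f x) y.
Proof.
  intros Hf; apply continuity_pt_eps; intros eps He.
  destruct (Hf (mkposreal eps He)) as [delta Hd].
  exists delta; split; [apply cond_pos|].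
  intros z Hz; apply Hd; [|exact Hz].
  rewrite Rminus_diag, Rabs_R0; apply cond_pos.
Qed.

(** Maximise in [y] for each [x], then in [x]. Uniform continuity on the rectangle makes the partial
    maximum [m] continuous, and clamping [x] makes [m] total. *)
Lemma rectangle_max (f : R -> R -> R) (a b c d : R) : a <= b -> c <= d ->
  (forall x y, a <= x <= b -> c <= y <= d -> continuity_2d_pt f x y) ->
  exists x y, a <= x <= b /\ c <= y <= d /\
    forall u v, a <= u <= b -> c <= v <= d -> f u v <= f x y.
Proof.
  intros Hab Hcd Hf.
  assert (Hm : forall x, {y | c <= y <= d /\
    forall v, c <= v <= d -> f (clamp a b x) v <= f (clamp a b x) y}).
  { intros x; apply constructive_indefinite_description.
    destruct (continuity_ab_maj (f (clamp a b x)) c d Hcd) as [y [Hy1 Hy2]].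
    - intros v Hv; apply continuity_2d_pt_section, Hf; [now apply clamp_bounds|exact Hv].
    - now exists y. }
  set (m := fun x => f (clamp a b x) (proj1_sig (Hm x))).
  assert (Hc : continuity m).
  { intros x; apply continuity_pt_eps; intros eps He.
    destruct (uniform_continuity_2d f a b c d Hf (mkposreal eps He)) as [delta Hd].
    exists delta; split; [apply cond_pos|]; intros y Hy.
    assert (Hxy : Rabs (clamp a b y - clamp a b x) < delta)
      by (eapply Rle_lt_trans; [apply clamp_lipschitz|exact Hy]).
    assert (Hyx : Rabs (clamp a b x - clamp a b y) < delta)
      by (rewrite Rabs_minus_sym; exact Hxy).
    assert (Bx := clamp_bounds a b x Hab); assert (By := clamp_bounds a b y Hab).
    assert (H0 : forall v, Rabs (v - v) < delta)
      by (intros v; rewrite Rminus_diag, Rabs_R0; apply cond_pos).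
    unfold m; destruct (Hm x) as [vx [Vx1 Vx2]]; destruct (Hm y) as [vy [Vy1 Vy2]]; simpl.
    assert (K1 := Hd _ _ _ _ Bx Vx1 By Vx1 Hxy (H0 vx)).
    assert (K2 := Hd _ _ _ _ Bx Vy1 By Vy1 Hxy (H0 vy)).
    simpl in K1, K2; apply Rabs_def2 in K1; apply Rabs_def2 in K2.
    assert (L1 := Vx2 vy Vy1); assert (L2 := Vy2 vx Vx1).
    apply Rabs_def1; lra. }
  destruct (continuity_ab_maj m a b Hab (fun x _ => Hc x)) as [x [Hx1 Hx2]].
  exists x, (proj1_sig (Hm x)); split; [exact Hx2|].
  split; [apply (proj2_sig (Hm x))|].
  intros u v Hu Hv; apply Rle_trans with (m u).
  - rewrite <- (clamp_id a b u Hu) at 1; now apply (proj2_sig (Hm u)).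
  - rewrite <- (clamp_id a b x Hx2) at 1; now apply Hx1.
Qed.

(** Serves for a maximum over an annulus that may sit on the inner circle, where only larger radii
    are available for comparison. *)
Lemma derive_pos_right (f : R -> R) x l e : is_derive f x l -> 0 < l -> 0 < e ->
  exists y, x < y < x + e /\ f x < f y.
Proof.
  intros Hf Hl He; apply is_derive_Reals in Hf.
  destruct (Hf l Hl) as [delta Hd].
  set (h := Rmin (delta / 2) (e / 2)).
  assert (Hdp := cond_pos delta).
  assert (Hh : 0 < h) by (apply Rmin_pos; lra).
  assert (Hh1 : h <= delta / 2) by apply Rmin_l.
  assert (Hh2 : h <= e / 2) by apply Rmin_r.
  exists (x + h); split; [lra|].
  assert (K := Hd h).
  rewrite (Rabs_pos_eq h) in K by lra.
  assert (K' := K ltac:(lra) ltac:(lra)); apply Rabs_def2 in K'.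
  assert (0 < (f (x + h) - f x) / h) by lra.
  assert (0 < (f (x + h) - f x) / h * h) by now apply Rmult_lt_0_compat.
  unfold Rdiv in *; rewrite Rmult_assoc, Rinv_l in H0 by lra; lra.
Qed.

Lemma local_max_derive (f : R -> R) x l : is_derive f x l ->
  (forall y, x - 1 < y < x + 1 -> f y <= f x) -> l = 0.
Proof.
  intros Hf Hmax; apply is_derive_Reals in Hf.
  rewrite <- (deriv_maximum f (x - 1) (x + 1) x (exist _ l Hf)); try lra.
  - reflexivity.
  - intros y H1 H2; apply Hmax; lra.
Qed.

(* [Phi = r^(4(k+1)) b^2 / (a^2 + b^2)] vanishes for [r = rad].  At a positive maximum
   over the annulus [Phi_t = 0] and [r Phi_r <= 0], whereas the system gives
   [r Phi_r / Phi = 2 + 2 k / (a^2 + b^2)]. *)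
Lemma annulus_uniqueness (k : nat) (a b : R -> R -> R) (r0 rad : R) :
  0 < r0 ->
  (forall r t, 0 < r -> continuity_2d_pt a r t /\ continuity_2d_pt b r t) ->
  (forall r t, a r (t + 2 * PI) = a r t /\ b r (t + 2 * PI) = b r t) ->
  (forall r t, 0 < r < rad -> exists ar at_ br bt,
    is_derive (fun s => a s t) r ar /\ is_derive (fun s => a r s) t at_ /\
    is_derive (fun s => b s t) r br /\ is_derive (fun s => b r s) t bt /\
    r * br + INR (S k) * b r t = at_ /\
    a r t * (a r t * at_ + b r t * bt)
    = b r t * (r * (a r t * ar + b r t * br)
               + INR k * (1 - a r t * a r t - b r t * b r t))) ->
  (forall t, b rad t = 0) ->
  (forall r t, r0 <= r <= rad -> 0 < a r t) ->
  forall r t, r0 <= r <= rad -> b r t = 0.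
Proof.
  intros Hr0 Hcont Hper Hsys Hbd Hpos r1 t1 Hr1.
  (* At a critical angle [r Phi_r / Phi = m - 4 k - 2 + 2 k / (a^2 + b^2)], so any exponent above
     [4 k + 2] would do. *)
  set (m := (4 * S k)%nat).
  assert (Em : INR m = 4 * (INR k + 1))
    by (unfold m; rewrite mult_INR, (S_INR k); simpl; ring).
  assert (Em' : m = S (pred m)) by reflexivity.
  clearbody m.
  set (M := fun r t => a r t * a r t + b r t * b r t).
  set (Phi := fun r t => r ^ m * (b r t * b r t) / M r t).
  assert (HM : forall r t, r0 <= r <= rad -> 0 < M r t)
    by (intros r t H; generalize (Hpos r t H); unfold M; nra).
  destruct (rectangle_max Phi r0 rad t1 (t1 + 2 * PI)) as (r & t & Hr & Ht & Hmax).
  { lra. }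
  { generalize PI_RGT_0; lra. }
  { intros x y Hx _; destruct (Hcont x y) as [Ca Cb]; [lra|].
    assert (M x y <> 0) by (generalize (HM x y Hx); lra).
    unfold Phi, M; cont2d. }
  destruct (Req_dec (b r1 t1) 0) as [|Hb1]; [assumption|exfalso].
  assert (HPI := PI_RGT_0).
  assert (Hpow : forall s, r0 <= s <= rad -> 0 < s ^ m) by (intros s Hs; apply pow_lt; lra).
  assert (HPhi : 0 < Phi r t).
  { apply Rlt_le_trans with (Phi r1 t1); [|apply Hmax; lra].
    apply Rdiv_lt_0_compat; [|now apply HM].
    apply Rmult_lt_0_compat; [now apply Hpow|nra]. }
  assert (Hb : b r t <> 0).
  { intros E; unfold Phi in HPhi; rewrite E in HPhi.
    unfold Rdiv in HPhi; rewrite Rmult_0_l, Rmult_0_r, Rmult_0_l in HPhi; lra. }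
  assert (Hrad : r < rad).
  { destruct (Req_dec r rad) as [->|]; [|lra]. now rewrite Hbd in Hb. }
  destruct (Hsys r t) as (ar & at_ & br & bt & Dar & Dat & Dbr & Dbt & E1 & E2); [lra|].
  assert (Ha := Hpos r t Hr); assert (HMr := HM r t Hr); assert (Hpr := Hpow r Hr).
  assert (Dt : is_derive (Phi r) t
    (r ^ m * 2 * (b r t * bt * M r t - b r t * b r t * (a r t * at_ + b r t * bt)) / M r t ^ 2)).
  { refine (is_derive_eq _ _ _ _ (is_derive_div (fun s => r ^ m * (b r s * b r s)) (M r) t _ _
      (is_derive_scal _ _ (r ^ m) _ (is_derive_Rmult _ _ _ _ _ Dbt Dbt))
      (is_derive_mult2_plus _ _ _ _ _ _ _ _ _ Dat Dat Dbt Dbt) _) _); [lra|].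
    unfold scal; simpl; unfold mult; simpl; field; lra. }
  assert (Dr : is_derive (fun s => Phi s t) r
    (r ^ pred m * ((INR m * (b r t * b r t) + 2 * r * b r t * br) * M r t
      - 2 * r * (b r t * b r t) * (a r t * ar + b r t * br)) / M r t ^ 2)).
  { assert (Dp : is_derive (fun s => s ^ m) r (INR m * r ^ pred m)).
    { auto_derive; [exact I|eqR; ring]. }
    refine (is_derive_eq _ _ _ _ (is_derive_div
      (fun s => s ^ m * (b s t * b s t)) (fun s => M s t) r _ _
      (is_derive_Rmult _ _ _ _ _ Dp (is_derive_Rmult _ _ _ _ _ Dbr Dbr))
      (is_derive_mult2_plus _ _ _ _ _ _ _ _ _ Dar Dar Dbr Dbr) _) _); [lra|].
    replace (r ^ m) with (r * r ^ pred m) by (rewrite Em' at 2; reflexivity).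
    eqR; field; lra. }
  (* Up to a positive factor [Phi_t] is [b a (a b_t - b a_t)]. As [a] and [b] are nonzero here, the
     argument of [a + ib] is stationary in the angle. *)
  assert (Zt : a r t * bt = b r t * at_).
  { assert (Z : r ^ m * 2 * (b r t * bt * M r t
        - b r t * b r t * (a r t * at_ + b r t * bt)) / M r t ^ 2 = 0).
    { apply (local_max_derive _ _ _ Dt); intros s Hs.
      (* An angle within distance 1 of [t] returns to the rectangle after at most one shift by the
         period, so a maximum on a lateral edge is still a local maximum in the angle. *)
      destruct (Rle_lt_dec t1 s) as [H1|H1]; [destruct (Rle_lt_dec s (t1 + 2 * PI)) as [H2|H2]|].
      - apply Hmax; lra.
      - assert (E : Phi r s = Phi r (s - 2 * PI)).
        { replace s with (s - 2 * PI + 2 * PI) at 1 by ring.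
          unfold Phi, M; destruct (Hper r (s - 2 * PI)) as [-> ->]; reflexivity. }
        rewrite E; apply Hmax; generalize PI_4 PI2_1; lra.
      - assert (E : Phi r s = Phi r (s + 2 * PI)).
        { unfold Phi, M; destruct (Hper r s) as [-> ->]; reflexivity. }
        rewrite E; apply Hmax; generalize PI_4 PI2_1; lra. }
    assert (Z' : b r t * (a r t * (a r t * bt - b r t * at_)) = 0).
    { apply (Rmult_eq_reg_l (r ^ m * 2 / M r t ^ 2)).
      - rewrite Rmult_0_r, <- Z; unfold M; field; fold (M r t); lra.
      - apply Rgt_not_eq; apply Rdiv_lt_0_compat; [lra|nra]. }
    apply Rmult_integral in Z'; destruct Z' as [|Z']; [lra|].
    apply Rmult_integral in Z'; destruct Z' as [|Z']; lra. }
  assert (Zr : 0 < (INR m * (b r t * b r t) + 2 * r * b r t * br) * M r t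
      - 2 * r * (b r t * b r t) * (a r t * ar + b r t * br)).
  { assert (E2' : r * (b r t * b r t) * (a r t * ar + b r t * br)
       = b r t * (M r t * at_) - b r t * b r t * INR k * (1 - M r t)).
    { transitivity (b r t * (a r t * (a r t * at_ + b r t * bt))
        - b r t * b r t * INR k * (1 - M r t)); [rewrite E2; unfold M; ring|].
      unfold M; replace (a r t * (a r t * at_ + b r t * bt))
        with (a r t * a r t * at_ + b r t * (a r t * bt)) by ring.
      rewrite Zt; ring. }
    rewrite <- E1 in E2'.
    rewrite Em.
    rewrite S_INR in E2'.
    apply Rlt_le_trans with (2 * (b r t * b r t) * (M r t + INR k)).
    - apply Rmult_lt_0_compat; [nra|generalize (pos_INR k); lra].
    - apply Req_le; symmetry; apply Rminus_diag_uniq.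
      transitivity (2 * (b r t * (M r t * (r * br + (INR k + 1) * b r t))
        - b r t * b r t * INR k * (1 - M r t)
        - r * (b r t * b r t) * (a r t * ar + b r t * br))); [ring|rewrite E2'; ring]. }
  (* Slightly larger radii exceed the maximum. This also covers [r = r0], which is why the inner
     circle needs no boundary condition. *)
  destruct (derive_pos_right _ _ _ (rad - r) Dr) as (s & Hs & Hlt); [|lra|].
  - apply Rdiv_lt_0_compat; [|nra]; apply Rmult_lt_0_compat; [apply pow_lt; lra|exact Zr].
  - apply (Rlt_not_le _ _ Hlt), Hmax; lra.
Qed.

Lemma periodic_reduce (t : R) : exists t', 0 <= t' <= 2 * PI /\
  forall f : R -> R, (forall s, f (s + 2 * PI) = f s) -> f t = f t'.
Proof.
  assert (HPI := PI_RGT_0).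
  destruct (base_fp (t / (2 * PI))) as [H1 H2].
  exists (2 * PI * frac_part (t / (2 * PI))); split; [nra|].
  intros f Hf.
  assert (Hn : forall n s, f (s + INR n * (2 * PI)) = f s).
  { induction n as [|n IH]; intros s.
    - simpl; f_equal; ring.
    - rewrite S_INR.
      replace (s + (INR n + 1) * (2 * PI)) with (s + INR n * (2 * PI) + 2 * PI) by ring.
      now rewrite Hf. }
  assert (E : t = 2 * PI * frac_part (t / (2 * PI)) + IZR (Int_part (t / (2 * PI))) * (2 * PI)).
  { unfold frac_part; field; lra. }
  rewrite E at 1; set (s := 2 * PI * frac_part (t / (2 * PI))).
  destruct (Z.le_gt_cases 0 (Int_part (t / (2 * PI)))) as [Hz|Hz].
  - rewrite <- (Z2Nat.id _ Hz), <- INR_IZR_INZ; apply Hn.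
  - set (z := Int_part (t / (2 * PI))) in *.
    rewrite <- (Hn (Z.to_nat (- z)) (s + IZR z * (2 * PI))).
    rewrite INR_IZR_INZ, Z2Nat.id by lia; rewrite opp_IZR; f_equal; ring.
Qed.

Lemma limit_nonneg (f : R -> R -> R) (s t e : R) : s < e ->
  continuity_2d_pt f s t -> (forall r, s < r <= e -> 0 <= f r t) -> 0 <= f s t.
Proof.
  intros Hse Hf Hpos; apply Rnot_lt_le; intros Hlt.
  destruct (locally_2d_lt f (fun _ _ => 0) s t Hf (continuity_2d_pt_const _ _ _) Hlt)
    as [delta Hd].
  assert (Hdp := cond_pos delta).
  set (h := Rmin (delta / 2) (e - s)).
  assert (0 < h) by (apply Rmin_pos; lra).
  assert (h <= delta / 2) by apply Rmin_l.
  assert (h <= e - s) by apply Rmin_r.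
  apply (Rlt_not_le _ _ (Hd (s + h) t
    ltac:(apply Rabs_def1; lra) ltac:(apply Rabs_def1; lra))).
  apply Hpos; lra.
Qed.

(** Continuation inwards: let [s] be the supremum of the radii in [[r1, rad]] on whose circle
    [a <= 0] occurs. If [s < rad], then [b] vanishes beyond [s] by the annulus result, hence also at
    [s] by continuity; since [a] and [b] have no common zero, [a] is positive on that circle. If
    [s = rad], the boundary data say so. Compactness of the circle gives positivity slightly further
    in, against the choice of [s]. *)
Lemma disk_uniqueness (k : nat) (a b : R -> R -> R) (rad : R) :
  (forall r t, 0 < r -> continuity_2d_pt a r t /\ continuity_2d_pt b r t) ->
  (forall r t, a r (t + 2 * PI) = a r t /\ b r (t + 2 * PI) = b r t) ->
  (forall r t, 0 < r < rad -> exists ar at_ br bt,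
    is_derive (fun s => a s t) r ar /\ is_derive (fun s => a r s) t at_ /\
    is_derive (fun s => b s t) r br /\ is_derive (fun s => b r s) t bt /\
    r * br + INR (S k) * b r t = at_ /\
    a r t * (a r t * at_ + b r t * bt)
    = b r t * (r * (a r t * ar + b r t * br)
               + INR k * (1 - a r t * a r t - b r t * b r t))) ->
  (forall t, b rad t = 0) -> (forall t, 0 < a rad t) ->
  (forall r t, 0 < r <= rad -> a r t <> 0 \/ b r t <> 0) ->
  forall r t, 0 < r <= rad -> b r t = 0 /\ 0 < a r t.
Proof.
  intros Hcont Hper Hsys Hb1 Ha1 Hnz.
  assert (Hpos : forall r t, 0 < r <= rad -> 0 < a r t).
  2: { intros r t Hr; split; [|now apply Hpos].
       apply (annulus_uniqueness k a b r rad); try assumption; try lra.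
       intros; apply Hpos; lra. }
  intros r1 t1 Hr1; apply Rnot_le_lt; intros Hneg.
  assert (HPI := PI_RGT_0).
  set (E := fun r => r1 <= r <= rad /\ exists t, a r t <= 0).
  destruct (completeness E) as [s [Hs1 Hs2]].
  { exists rad; intros r [Hr _]; lra. }
  { exists r1; split; [lra|now exists t1]. }
  assert (Hs : r1 <= s <= rad).
  { split; [apply Hs1; split; [lra|now exists t1]|apply Hs2; intros r [Hr _]; lra]. }
  assert (Hafter : forall r t, s < r <= rad -> 0 < a r t).
  { intros r t Hr; apply Rnot_le_lt; intros Hle.
    apply (Rlt_not_le r s); [lra|apply Hs1; split; [lra|now exists t]]. }
  assert (Hsa : forall t, 0 < a s t).
  { intros t; destruct (Req_dec s rad) as [->|Hsr]; [apply Ha1|].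
    destruct (Hcont s t) as [Ca Cb]; [lra|].
    assert (Hb : forall r, s < r <= rad -> b r t = 0).
    { intros r Hr; apply (annulus_uniqueness k a b r rad); try assumption; try lra.
      intros r' t' Hr'; apply Hafter; lra. }
    assert (0 <= a s t).
    { apply (limit_nonneg a s t rad); [lra|exact Ca|].
      intros r Hr; left; now apply Hafter. }
    assert (0 <= b s t).
    { apply (limit_nonneg b s t rad); [lra|exact Cb|].
      intros r Hr; rewrite Hb; lra. }
    assert (0 <= - b s t).
    { apply (limit_nonneg (fun r t => - b r t) s t rad); [lra|cont2d|].
      intros r Hr; rewrite Hb; lra. }
    destruct (Hnz s t); lra. }
  (* A degenerate rectangle: it yields the minimum of [a] on the circle of radius [s], which then
     serves as the tolerance in the uniform continuity of [a]. *)
  destruct (rectangle_max (fun r t => - a r t) s s 0 (2 * PI)) as (x & tm & Hx & Htm & Hmax).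
  { lra. } { lra. }
  { intros x y Hx Hy; destruct (Hcont x y); [lra|cont2d]. }
  replace x with s in Hmax by lra.
  destruct (uniform_continuity_2d a r1 rad 0 (2 * PI)) with (eps := mkposreal _ (Hsa tm))
    as [delta Hd].
  { intros x' y Hx' Hy; destruct (Hcont x' y); [lra|assumption]. }
  assert (Hdp := cond_pos delta).
  assert (Hub : is_upper_bound E (s - delta / 2)).
  { intros r [Hr [t Ht]]; apply Rnot_lt_le; intros Hlt.
    assert (r <= s) by (apply Hs1; split; [exact Hr|now exists t]).
    destruct (periodic_reduce t) as [t' [Ht' Hf]].
    rewrite (Hf (a r)) in Ht by (intros; apply Hper).
    assert (K := Hd s t' r t' Hs Ht' Hr Ht' ltac:(apply Rabs_def1; lra)
      ltac:(apply Rabs_def1; lra)).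
    simpl in K; apply Rabs_def2 in K.
    assert (L := Hmax s t' ltac:(lra) Ht'); lra. }
  assert (Z := Hs2 _ Hub); lra.
Qed.

(** * Uniqueness of the radial profile *)

Lemma MVT_open (f f' : R -> R) (a b : R) : a < b ->
  (forall x, a < x < b -> is_derive f x (f' x)) ->
  (forall x, a <= x <= b -> continuity_pt f x) ->
  exists c, a < c < b /\ f b - f a = f' c * (b - a).
Proof.
  intros Hab Hd Hc.
  assert (Hd' : forall x, a < x < b -> derivable_pt_lim f x (f' x))
    by (intros x Hx; now apply is_derive_Reals, Hd).
  destruct (MVT f id a b (fun c P => exist _ (f' c) (Hd' c P))
    (fun c _ => derivable_pt_id c) Hab Hc) as (c & P & E).
  { intros x _; apply derivable_continuous, derivable_id. }
  exists c; split; [exact P|].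
  rewrite derive_pt_id in E; simpl in E; unfold id in E; lra.
Qed.

Lemma derive_nonneg_le (f f' : R -> R) (a b : R) : a <= b ->
  (forall x, a <= x <= b -> is_derive f x (f' x)) ->
  (forall x, a <= x <= b -> 0 <= f' x) -> f a <= f b.
Proof.
  intros [Hab| ->] Hd Hpos; [|lra].
  destruct (MVT_open f f' a b Hab) as (c & Hc & E).
  - intros x Hx; apply Hd; lra.
  - intros x Hx; apply derivable_continuous_pt; exists (f' x).
    now apply is_derive_Reals, Hd.
  - assert (0 <= f' c) by (apply Hpos; lra); nra.
Qed.

Lemma continuity_pos (f : R -> R) x : continuity_pt f x -> 0 < f x ->
  exists delta, 0 < delta /\ forall y, Rabs (y - x) < delta -> 0 < f y.
Proof.
  intros Hf Hx; destruct (Hf (f x) Hx) as [delta [Hd H]].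
  exists delta; split; [exact Hd|]; intros y Hy.
  destruct (Req_dec x y) as [<-|Hne]; [exact Hx|].
  assert (K := H y (conj (conj I Hne) Hy)); simpl in K; unfold Rdist in K.
  apply Rabs_def2 in K; lra.
Qed.

Lemma last_zero_before (h : R -> R) (a x : R) : continuity h -> a < x ->
  h a = 0 -> 0 < h x ->
  exists c, a <= c < x /\ h c = 0 /\ forall y, c < y <= x -> 0 < h y.
Proof.
  intros Hh Hax Ha Hx.
  set (E := fun y => a <= y <= x /\ h y <= 0).
  destruct (completeness E) as [c [Hc1 Hc2]].
  { exists x; intros y [Hy _]; lra. }
  { exists a; split; lra. }
  assert (Hac : a <= c) by (apply Hc1; split; lra).
  assert (Hcx : c <= x) by (apply Hc2; intros y [Hy _]; lra).
  assert (Hle : h c <= 0).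
  { apply Rnot_lt_le; intros Hlt.
    destruct (continuity_pos h c (Hh c) Hlt) as [delta [Hd Hpos]].
    assert (c <= c - delta / 2); [|lra].
    apply Hc2; intros y [Hy1 Hy2]; apply Rnot_lt_le; intros Hy3.
    assert (y <= c) by (apply Hc1; now split).
    apply (Rlt_not_le _ _ (Hpos y ltac:(apply Rabs_def1; lra))); lra. }
  assert (Hc : c < x) by (destruct Hcx as [| ->]; lra).
  assert (Hafter : forall y, c < y <= x -> 0 < h y).
  { intros y Hy; apply Rnot_le_lt; intros Hyle.
    assert (y <= c) by (apply Hc1; split; lra); lra. }
  exists c; split; [lra|split; [|exact Hafter]].
  apply Rle_antisym; [exact Hle|].
  apply (limit_nonneg (fun r _ => h r) c 0 x Hc).
  - apply (continuity_1d_2d_pt_comp h (fun r _ => r)); [apply Hh|apply continuity_2d_pt_id1].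
  - intros r Hr; left; now apply Hafter.
Qed.

Lemma first_zero_after (h : R -> R) (x b : R) : continuity h -> x < b ->
  h b = 0 -> 0 < h x ->
  exists c, x < c <= b /\ h c = 0 /\ forall y, x <= y < c -> 0 < h y.
Proof.
  intros Hh Hxb Hb Hx.
  destruct (last_zero_before (fun y => h (- y)) (- b) (- x)) as (c & Hc1 & Hc2 & Hc3).
  - apply (continuity_comp Ropp h); [|exact Hh].
    apply derivable_continuous, derivable_opp, derivable_id.
  - lra.
  - now rewrite Ropp_involutive.
  - now rewrite Ropp_involutive.
  - exists (- c); split; [lra|split; [exact Hc2|]].
    intros y Hy; rewrite <- (Ropp_involutive y); apply Hc3; lra.
Qed.

(** The radial equation solved for the second derivative. *)
Definition radial_rhs (d : nat) (r H H' : R) : R :=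
  INR d ^ 2 / r ^ 2 * H - 1 / r * H' - H * (1 - H ^ 2).

(** The derivative is a separate argument so that a clamped, globally continuous extension can be
    paired with the derivative of the original function. *)
Definition radial_profile (d : nat) (rad : R) (H H' : R -> R) : Prop :=
  continuity H /\ H 0 = 0 /\
  forall r, 0 < r < rad ->
    is_derive H r (H' r) /\ is_derive H' r (radial_rhs d r (H r) (H' r)).

Lemma continuous_on_segment_clamp (a b : R) (f : R -> R) : a <= b ->
  continuous_on (segment a b) f -> continuity (fun x => f (clamp a b x)).
Proof.
  intros Hab Hf x; apply continuity_pt_eps; intros eps He.
  destruct (Hf (clamp a b x) (clamp_bounds a b x Hab) _ (locally_ball _ (mkposreal eps He)))
    as [delta Hd].
  exists delta; split; [apply cond_pos|]; intros y Hy.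
  apply (Hd (clamp a b y)); [|now apply clamp_bounds].
  eapply Rle_lt_trans; [apply clamp_lipschitz|exact Hy].
Qed.

Lemma locally_between (a b x : R) : a < x < b -> locally x (fun y => a < y < b).
Proof.
  intros Hx; apply (open_and _ _ (open_gt a) (open_lt b)); exact Hx.
Qed.

Lemma radial_solution_profile (d : nat) (rad : R) (F : R -> R) : 0 < rad ->
  radial_solution d rad F ->
  radial_profile d rad (fun x => F (clamp 0 rad x)) (Derive F).
Proof.
  intros Hrad (Hc & Hode & H0 & _); split; [|split].
  - apply continuous_on_segment_clamp; [lra|exact Hc].
  - now rewrite clamp_id by lra.
  - intros r Hr; destruct (Hode r Hr) as (D1 & D2 & E).
    rewrite clamp_id by lra; split.
    + apply (is_derive_ext_loc F); [|now apply Derive_correct].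
      apply (filter_imp (fun y => 0 < y < rad)); [|apply locally_between; lra].
      intros y Hy; now rewrite clamp_id by lra.
    + refine (is_derive_eq _ _ _ _ (Derive_correct _ _ D2) _).
      change (Derive_n F 2 r) with (Derive (Derive F) r) in E.
      unfold radial_rhs; rewrite <- E; eqR; ring.
Qed.

(* [r H'] is nondecreasing for small [r], and a negative value would force [H < 0]. *)
Lemma radial_profile_near_0 (d : nat) (rad : R) (H H' : R -> R) : (1 <= d)%nat -> 0 < rad ->
  radial_profile d rad H H' -> (forall r, 0 < r < rad -> 0 <= H r) ->
  exists r0 c, 0 < r0 < rad /\ forall r, 0 < r <= r0 -> 0 <= r * H' r <= c.
Proof.
  intros Hd Hrad (Hc & H0 & Hode) Hpos.
  set (r0 := Rmin 1 (rad / 2)).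
  assert (Hr0 : 0 < r0) by (apply Rmin_pos; lra).
  assert (Hr1 : r0 <= 1) by apply Rmin_l.
  assert (Hr2 : r0 <= rad / 2) by apply Rmin_r.
  assert (Hd1 : 1 <= INR d) by (apply (le_INR 1); exact Hd).
  assert (Hmono : forall s r, 0 < s -> s <= r -> r <= r0 -> s * H' s <= r * H' r).
  { intros s r Hs Hsr Hr.
    apply (derive_nonneg_le (fun x => x * H' x)
      (fun x => 1 * H' x + x * radial_rhs d x (H x) (H' x)) s r Hsr).
    - intros x Hx; apply (is_derive_Rmult (fun x => x)); [exact (is_derive_id x)|apply Hode; lra].
    - intros x Hx; unfold radial_rhs.
      assert (Px := Hpos x ltac:(lra)).
      (* This is [(x H')'] after inserting the equation; it is nonnegative because [x <= 1 <= d],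
         which is the reason for taking [r0] at most 1. *)
      replace (_ + _) with (H x * ((INR d ^ 2 - x ^ 2) / x + x * H x ^ 2)) by (field; lra).
      apply Rmult_le_pos; [exact Px|].
      apply Rplus_le_le_0_compat; [|nra].
      apply Rdiv_le_0_compat; [nra|lra]. }
  exists r0, (r0 * H' r0); split; [lra|].
  intros r Hr; split; [|apply Hmono; lra].
  apply Rnot_lt_le; intros Hneg.
  destruct (MVT_open H H' 0 r) as (c & Hcr & E); [lra| |intros; apply Hc|].
  - intros x Hx; apply Hode; lra.
  - assert (K := Hmono c r ltac:(lra) ltac:(lra) ltac:(lra)).
    assert (P := Hpos r ltac:(lra)).
    assert (H' c < 0) by nra.
    nra.
Qed.

(* Wronskian argument on a maximal interval [(al, be)] where [sg (G - F) > 0]: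
   [om = r (F' G - F G')] has [om' = r F G (F^2 - G^2)] and [(G/F)' = - om / (r F^2)].
   If [al = 0], the sign of [om] comes from [om -> 0] at the origin. *)
Lemma radial_profile_no_crossing (d : nat) (rad : R) (F F' G G' : R -> R) (sg x : R) :
  (1 <= d)%nat -> radial_profile d rad F F' -> radial_profile d rad G G' ->
  (forall r, 0 < r <= rad -> 0 < F r) -> (forall r, 0 < r <= rad -> 0 <= G r) ->
  F rad = G rad -> sg = 1 \/ sg = -1 -> 0 < x < rad ->
  sg * (G x - F x) <= 0.
Proof.
  intros Hd HF HG FPos GPos Hrad Hsg Hx; apply Rnot_lt_le; intros Hpos.
  assert (HF0 := HF); assert (HG0 := HG).
  destruct HF0 as (CF & F0 & DF); destruct HG0 as (CG & G0 & DG).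
  assert (Hs2 : sg * sg = 1) by (destruct Hsg as [-> | ->]; ring).
  (* The sign [sg] treats both orders of [F] and [G] at once. Their roles still differ: the quotient
     [G / F] is formed, and only [F] is known to be positive. *)
  set (h := fun y => sg * (G y - F y)).
  assert (Ch : continuity h).
  { apply (continuity_scal (fun y => G y - F y)), continuity_minus; assumption. }
  destruct (last_zero_before h 0 x Ch) as (al & Hal & Ea & Pa);
    [lra|unfold h; rewrite F0, G0; ring|exact Hpos|].
  destruct (first_zero_after h x rad Ch) as (be & Hbe & Eb & Pb);
    [lra|unfold h; rewrite Hrad; ring|exact Hpos|].
  assert (Ph : forall y, al < y < be -> 0 < h y).
  { intros y Hy; destruct (Rle_lt_dec y x); [apply Pa|apply Pb]; lra. }
  set (om := fun r => r * (F' r * G r - F r * G' r)).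
  assert (Dom : forall r, 0 < r < rad -> is_derive (fun r => - sg * om r) r
    (r * F r * G r * (F r + G r) * h r)).
  { intros r Hr; destruct (DF r Hr) as [F1 F2]; destruct (DG r Hr) as [G1 G2].
    refine (is_derive_eq _ _ _ _ (is_derive_scal _ _ (- sg) _
      (is_derive_Rmult (fun r => r) _ _ _ _ (is_derive_id r)
        (is_derive_mult2_minus _ _ _ _ _ _ _ _ _ F2 G1 F1 G2))) _).
    unfold radial_rhs, h, scal, one; simpl; unfold mult; simpl; field; lra. }
  assert (Mom : forall s r, al < s -> s <= r -> r < be -> sg * om r <= sg * om s).
  { intros s r H1 H2 H3.
    assert (- sg * om s <= - sg * om r); [|lra].
    apply (derive_nonneg_le (fun r => - sg * om r)
      (fun r => r * F r * G r * (F r + G r) * h r) s r H2).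
    - intros y Hy; apply Dom; lra.
    - intros y Hy.
      assert (P1 := FPos y ltac:(lra)); assert (P2 := GPos y ltac:(lra)).
      assert (P3 := Ph y ltac:(lra)).
      apply Rmult_le_pos; [|lra].
      apply Rmult_le_pos; [|lra].
      apply Rmult_le_pos; [|lra].
      apply Rmult_le_pos; lra. }
  assert (Dq : forall r, 0 < r < rad ->
    is_derive (fun r => G r / F r) r (- om r / (r * F r ^ 2))).
  { intros r Hr; destruct (DF r Hr) as [F1 F2]; destruct (DG r Hr) as [G1 G2].
    assert (P1 := FPos r ltac:(lra)).
    refine (is_derive_eq _ _ _ _ (is_derive_div G F r _ _ G1 F1 _) _); [lra|].
    unfold om; eqR; field; lra. }
  assert (Cq : forall r, 0 < r <= rad -> continuity_pt (fun r => G r / F r) r).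
  { intros r Hr; assert (P1 := FPos r Hr).
    apply continuity_pt_div; [apply CG|apply CF|lra]. }
  assert (Eq : forall r, 0 < r <= rad -> h r = 0 -> G r / F r = 1).
  { intros r Hr Hh; assert (P1 := FPos r Hr).
    assert (E : G r = F r) by (unfold h in Hh; destruct Hsg as [E|E]; rewrite E in Hh; lra).
    rewrite E; field; lra. }
  assert (Hqx : 0 < sg * (G x / F x - 1)).
  { assert (P1 := FPos x ltac:(lra)).
    replace (sg * (G x / F x - 1)) with (sg * (G x - F x) / F x) by (field; lra).
    now apply Rdiv_lt_0_compat. }
  assert (Hden : forall r, 0 < r < rad -> 0 < r * F r ^ 2).
  { intros r Hr; assert (P1 := FPos r ltac:(lra)); apply Rmult_lt_0_compat; [lra|nra]. }
  assert (Hom : forall r, x <= r < be -> sg * om r <= 0).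
  { intros r Hr; destruct (Rle_lt_or_eq_dec 0 al (proj1 Hal)) as [Hal0|Hal0].
    (* [sg * (G / F)] rises from [sg] at [al] to a larger value at [x], so [sg * om] is nonpositive
       somewhere in between; monotonicity carries this on to [r]. *)
    - destruct (MVT_open (fun r => G r / F r) (fun r => - om r / (r * F r ^ 2)) al x)
        as (c & Hc & E); [lra|intros y Hy; apply Dq; lra|intros y Hy; apply Cq; lra|].
      rewrite (Eq al) in E; [|lra|exact Ea].
      assert (P := Hden c ltac:(lra)).
      assert (sg * om c <= 0); [|apply Rle_trans with (sg * om c); [apply Mom; lra|assumption]].
      apply Rnot_lt_le; intros Hlt.
      assert (E' : sg * (G x / F x - 1) * (c * F c ^ 2) = - (sg * om c * (x - al))).
      { rewrite E; field; generalize (FPos c); lra. }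
      assert (0 < sg * (G x / F x - 1) * (c * F c ^ 2)) by now apply Rmult_lt_0_compat.
      assert (0 < sg * om c * (x - al)) by (apply Rmult_lt_0_compat; lra).
      lra.
    - apply Rnot_lt_le; intros Hlt.
      destruct (radial_profile_near_0 d rad F F' Hd) as (r1 & c1 & Hr1 & B1);
        [lra|exact HF|intros y Hy; left; apply FPos; lra|].
      destruct (radial_profile_near_0 d rad G G' Hd) as (r2 & c2 & Hr2 & B2);
        [lra|exact HG|intros y Hy; apply GPos; lra|].
      assert (C1 := B1 r1 ltac:(lra)); assert (C2 := B2 r2 ltac:(lra)).
      (* Near the origin [sg * om s] is at most [c1 * G s + c2 * F s], which tends to 0, whereas
         monotonicity keeps it above the supposedly positive [sg * om r]. *)
      assert (Hcont : continuity (fun s => sg * om r - (c1 * G s + c2 * F s))).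
      { apply continuity_minus; [apply continuity_const; now intros ? ?|].
        apply continuity_plus; now apply continuity_scal. }
      destruct (continuity_pos _ 0 (Hcont 0)) as (delta & Hdel & Hnear).
      { rewrite F0, G0, !Rmult_0_r; lra. }
      set (s := Rmin (delta / 2) (Rmin r (Rmin r1 r2))).
      assert (0 < s) by (repeat apply Rmin_pos; lra).
      assert (s <= delta / 2) by apply Rmin_l.
      assert (s <= Rmin r (Rmin r1 r2)) by apply Rmin_r.
      assert (Rmin r (Rmin r1 r2) <= r) by apply Rmin_l.
      assert (Rmin r (Rmin r1 r2) <= Rmin r1 r2) by apply Rmin_r.
      assert (Rmin r1 r2 <= r1) by apply Rmin_l.
      assert (Rmin r1 r2 <= r2) by apply Rmin_r.
      assert (K := Hnear s ltac:(apply Rabs_def1; lra)).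
      assert (L := Mom s r ltac:(lra) ltac:(lra) ltac:(lra)).
      assert (K1 := B1 s ltac:(lra)); assert (K2 := B2 s ltac:(lra)).
      assert (P1 := FPos s ltac:(lra)); assert (P2 := GPos s ltac:(lra)).
      assert (Hup : sg * om s <= c1 * G s + c2 * F s).
      { assert (0 <= s * F' s * G s <= c1 * G s).
        { split; [apply Rmult_le_pos; lra|apply Rmult_le_compat_r; lra]. }
        assert (0 <= s * G' s * F s <= c2 * F s).
        { split; [apply Rmult_le_pos; lra|apply Rmult_le_compat_r; lra]. }
        replace (om s) with (s * F' s * G s - s * G' s * F s) by (unfold om; ring).
        destruct Hsg as [-> | ->]; lra. }
      lra. }
  (* On [[x, be]] the sign of [om] forbids [sg * (G / F)] to decrease, yet it would have to come
     back to [sg] at [be]. *)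
  destruct (MVT_open (fun r => G r / F r) (fun r => - om r / (r * F r ^ 2)) x be)
    as (c & Hc & E); [lra|intros y Hy; apply Dq; lra|intros y Hy; apply Cq; lra|].
  rewrite (Eq be) in E; [|lra|exact Eb].
  assert (P := Hden c ltac:(lra)).
  assert (E' : sg * (G x / F x - 1) * (c * F c ^ 2) = sg * om c * (be - x)).
  { replace (G x / F x - 1) with (- (1 - G x / F x)) by ring.
    rewrite E; field; generalize (FPos c); lra. }
  assert (0 < sg * (G x / F x - 1) * (c * F c ^ 2)) by now apply Rmult_lt_0_compat.
  assert (Z := Hom c ltac:(lra)); nra.
Qed.

Lemma radial_solution_unique (d : nat) (rad : R) (F G : R -> R) :
  (1 <= d)%nat -> 0 < rad -> radial_solution d rad F -> (forall r, 0 < r <= rad -> 0 < F r) ->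
  nonneg_radial_solution d rad G ->
  forall r, segment 0 rad r -> G r = F r.
Proof.
  intros Hd Hrad HF FPos [HG GPos] r Hr; unfold segment in Hr.
  assert (PF := radial_solution_profile d rad F Hrad HF).
  assert (PG := radial_solution_profile d rad G Hrad HG).
  destruct HF as (_ & _ & F0 & F1); destruct HG as (_ & _ & G0 & G1).
  destruct (Req_dec r 0) as [->|H0]; [now rewrite F0, G0|].
  destruct (Req_dec r rad) as [->|H1]; [now rewrite F1, G1|].
  assert (K : forall sg, sg = 1 \/ sg = -1 -> sg * (G r - F r) <= 0).
  { intros sg Hsg.
    assert (Z := radial_profile_no_crossing d rad _ _ _ _ sg r Hd PF PG).
    cbv beta in Z; rewrite (clamp_id 0 rad r Hr) in Z; apply Z; try lra.
    - intros s Hs; rewrite clamp_id by lra; now apply FPos.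
    - intros s Hs; rewrite clamp_id by lra; apply GPos; unfold segment; lra.
    - rewrite clamp_id by lra; now rewrite F1, G1. }
  assert (K1 := K 1 ltac:(now left)); assert (K2 := K (-1) ltac:(now right)); lra.
Qed.

(** * Symmetry of the solution *)

Lemma polar_coords r t : polar r t = (r * cos t, r * sin t).
Proof. unfold polar, expi; apply injective_projections; simpl; ring. Qed.

Lemma polar_norm2 r t : (r * cos t) ^ 2 + (r * sin t) ^ 2 = r ^ 2.
Proof.
  generalize (sin2_cos2 t); unfold Rsqr; intros E.
  transitivity (r ^ 2 * (sin t * sin t + cos t * cos t)); [ring|rewrite E; ring].
Qed.

Lemma Cmod_polar_coords r t : 0 <= r -> Cmod (r * cos t, r * sin t) = r.
Proof. intros Hr; rewrite Cmod_pair, polar_norm2; now apply sqrt_pow2. Qed.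

Lemma clamp_continuity a b : continuity (clamp a b).
Proof.
  intros x; apply continuity_pt_eps; intros eps He; exists eps; split; [exact He|].
  intros y Hy; eapply Rle_lt_trans; [apply clamp_lipschitz|exact Hy].
Qed.

Lemma continuous_on_disk_polar (rad : R) (u : C -> C) : 0 < rad ->
  continuous_on (closed_disk rad) u -> forall r t,
  continuity_2d_pt (fun r t => comp1 u (clamp 0 rad r * cos t) (clamp 0 rad r * sin t)) r t /\
  continuity_2d_pt (fun r t => comp2 u (clamp 0 rad r * cos t) (clamp 0 rad r * sin t)) r t.
Proof.
  intros Hrad Hu r t.
  assert (CC : continuity_2d_pt (fun r _ => clamp 0 rad r) r t).
  { apply (continuity_1d_2d_pt_comp (clamp 0 rad) (fun r _ => r));
      [apply clamp_continuity|apply continuity_2d_pt_id1]. }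
  assert (CX : continuity_2d_pt (fun r t => clamp 0 rad r * cos t) r t).
  { apply continuity_2d_pt_mult; [exact CC|].
    apply (continuity_1d_2d_pt_comp cos (fun _ t => t)); [|apply continuity_2d_pt_id2].
    apply derivable_continuous, derivable_cos. }
  assert (CY : continuity_2d_pt (fun r t => clamp 0 rad r * sin t) r t).
  { apply continuity_2d_pt_mult; [exact CC|].
    apply (continuity_1d_2d_pt_comp sin (fun _ t => t)); [|apply continuity_2d_pt_id2].
    apply derivable_continuous, derivable_sin. }
  assert (HD : forall r t, closed_disk rad (clamp 0 rad r * cos t, clamp 0 rad r * sin t)).
  { intros r' t'; unfold closed_disk.
    destruct (clamp_bounds 0 rad r') as [H1 H2]; [lra|].
    now rewrite Cmod_polar_coords. }
  split; intros eps;
    destruct (Hu _ (HD r t) _ (locally_ball _ eps)) as [delta Hd];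
    generalize (locally_2d_and _ _ _ _ (CX delta) (CY delta));
    apply locally_2d_impl, locally_2d_forall; intros r' t' [H1 H2];
    apply (Hd (clamp 0 rad r' * cos t', clamp 0 rad r' * sin t') (conj H1 H2) (HD r' t')).
Qed.

Lemma continuous_on_segment_of_clamp (a b : R) (f : R -> R) :
  continuity (fun x => f (clamp a b x)) -> continuous_on (segment a b) f.
Proof.
  intros Hf x Hx P [eps HP].
  assert (K := proj1 (continuity_pt_filterlim _ _) (Hf x) _ (locally_ball _ eps)).
  unfold filtermap in K |- *; unfold within; revert K; apply filter_imp.
  intros y Hy Hseg; apply HP.
  now rewrite !clamp_id in Hy.
Qed.

Lemma GL_solution_components (rad : R) (u : C -> C) (x y : R) :
  GL_solution rad u -> disk rad (x, y) ->
  let p := comp1 u in let q := comp2 u in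
  ex_diff_n p 2 x y /\ ex_diff_n q 2 x y /\
  dx (dx p) x y + dy (dy p) x y = (p x y * p x y + q x y * q x y - 1) * p x y /\
  dx (dx q) x y + dy (dy q) x y = (p x y * p x y + q x y * q x y - 1) * q x y.
Proof.
  intros [_ H] Hd p q; destruct (H _ Hd) as [[H1 H2] E].
  split; [exact H1|split; [exact H2|]].
  assert (EM : Cmod (u (x, y)) ^ 2 = p x y * p x y + q x y * q x y).
  { unfold Cmod; rewrite pow2_sqrt by nra; unfold p, q, comp1, comp2; ring. }
  assert (E1 := f_equal fst E); assert (E2 := f_equal snd E).
  rewrite EM in E1, E2; simpl in E1, E2.
  change (- (dx (dx p) x y + dy (dy p) x y)
    = p x y * (1 - (p x y * p x y + q x y * q x y)) - q x y * 0) in E1.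
  change (- (dx (dx q) x y + dy (dy q) x y)
    = p x y * 0 + q x y * (1 - (p x y * p x y + q x y * q x y))) in E2.
  split; lra.
Qed.

Lemma open_punctured_disk rad : open_2d (fun x y => disk rad (x, y) /\ punctured x y).
Proof.
  intros x y [H1 H2]; apply locally_2d_and; [now apply open_disk_2d|].
  apply (continuity_2d_pt_neq_0 (fun x y => x ^ 2 + y ^ 2)); [cont2d|exact H2].
Qed.

(* The angular derivative of [p = F(r) cos (n t)] along a circle is known for all
   angles; differentiating it once more at [t = 0] gives [p_yy]. *)
Lemma radial_reduction (rad n : R) (p q : R -> R -> R) (F : R -> R) (r : R) :
  0 < r < rad -> (forall x y, disk rad (x, y) -> ex_diff_n p 2 x y) ->
  (forall t, p (r * cos t) (r * sin t) = F r * cos (n * t)) ->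
  dy (dy p) r 0 = dx p r 0 / r - n ^ 2 / r ^ 2 * F r.
Proof.
  intros Hr Hp Hpolar.
  assert (HO := open_disk_2d rad).
  assert (Od : forall t, disk rad (r * cos t, r * sin t)).
  { intros t; unfold disk; rewrite Cmod_polar_coords; lra. }
  assert (DX : forall t, is_derive (fun s => r * cos s) t (- r * sin t))
    by (intros t; auto_derive; trivial; ring).
  assert (DY : forall t, is_derive (fun s => r * sin s) t (r * cos t))
    by (intros t; auto_derive; trivial; ring).
  assert (H0 : forall x y, disk rad (x, y) -> ex_diff_n p 1 x y)
    by (intros; apply (ex_diff_n_m 2 1); auto).
  assert (H1 : forall x y, disk rad (x, y) -> ex_diff_n (dx p) 1 x y)
    by (intros; apply ex_diff_n_deriv_aux1; auto).
  assert (H2 : forall x y, disk rad (x, y) -> ex_diff_n (dy p) 1 x y)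
    by (intros; apply ex_diff_n_deriv_aux2; auto).
  assert (E1 : forall t, dx p (r * cos t) (r * sin t) * (- r * sin t)
    + dy p (r * cos t) (r * sin t) * (r * cos t) = - n * F r * sin (n * t)).
  { intros t.
    apply (is_derive_inj _ _ _ _ (chain_2d _ p (fun s => r * cos s)
      (fun s => r * sin s) t _ _ HO H0 (Od t) (DX t) (DY t))).
    apply (is_derive_ext (fun s => F r * cos (n * s))); [intros s; symmetry; apply Hpolar|].
    auto_derive; [exact I|eqR; ring]. }
  assert (D2 := is_derive_mult2_plus _ _ _ _ 0 _ _ _ _
    (chain_2d _ (dx p) (fun s => r * cos s) (fun s => r * sin s) 0 _ _ HO H1 (Od 0) (DX 0) (DY 0))
    (is_derive_scal _ _ (- r) _ (is_derive_sin 0))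
    (chain_2d _ (dy p) (fun s => r * cos s) (fun s => r * sin s) 0 _ _ HO H2 (Od 0) (DX 0) (DY 0))
    (DX 0)).
  assert (D3 : is_derive (fun t => - n * F r * sin (n * t)) 0 (- n * F r * n)).
  { auto_derive; [exact I|rewrite Rmult_0_r, cos_0; eqR; ring]. }
  apply (is_derive_ext _ _ _ _ (fun t => eq_sym (E1 t))) in D3.
  assert (E2 := is_derive_inj _ _ _ _ D2 D3).
  cbv beta in E2; rewrite cos_0, sin_0, !Rmult_0_r, !Rmult_1_r in E2.
  assert (Hr2 : r <> 0) by lra.
  apply (Rmult_eq_reg_l (r * r)); [|nra].
  transitivity (r * dx p r 0 - n * n * F r); [|field; exact Hr2].
  lra.
Qed.

Theorem theorem2 (rad : R) (d : nat) (u : C -> C)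
  (hrad : 0 < rad) (hd : (1 <= d)%nat)
  (hsol : GL_solution rad u)
  (hdeg : has_degree rad u d)
  (hbdry : forall t : R, u (polar rad t) = expi (INR d * t))
  (hzero : forall x0 : C, closed_disk rad x0 -> (u x0 = 0%C <-> x0 = 0%C))
  (hcurl : root_pullback_curl_free rad d u) :
  exists F : R -> R,
    unique_nonneg_radial_solution d rad F /\
    forall r t : R, 0 <= r <= rad ->
      u (polar r t) = (expi (INR d * t) * RtoC (F r))%C.
Proof.
  destruct d as [|k]; [lia|].
  set (p := comp1 u); set (q := comp2 u); set (n := INR (S k)).
  assert (Hn2 : forall t, sin (n * t) * sin (n * t) + cos (n * t) * cos (n * t) = 1)
    by (intros t; exact (sin2_cos2 (n * t))).
  assert (HPDE := fun x y => GL_solution_components rad u x y hsol).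
  fold p q in HPDE.
  assert (HC2 : forall x y, disk rad (x, y) -> C2_at u (x, y))
    by (intros x y Hxy; split; apply HPDE; exact Hxy).
  (* Clamping the radius makes [a] and [b] continuous for every real [r], although [u] is controlled
     only on the closed disk. *)
  set (a := fun r t => rot_re n p q (clamp 0 rad r) t).
  set (b := fun r t => rot_im n p q (clamp 0 rad r) t).
  assert (Hbd : forall t, a rad t = 1 /\ b rad t = 0).
  { intros t; unfold a, b, rot_re, rot_im, p, q, comp1, comp2.
    rewrite clamp_id by lra; rewrite <- polar_coords, hbdry; fold n; unfold expi; simpl.
    split; [rewrite <- (Hn2 t); ring|ring]. }
  assert (Hcont : forall r t, continuity_2d_pt a r t /\ continuity_2d_pt b r t).
  { intros r t.
    destruct (continuous_on_disk_polar rad u hrad (proj1 hsol) r t) as [Cp Cq].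
    assert (Ccos : continuity_2d_pt (fun _ t => cos (n * t)) r t).
    { apply (continuity_1d_2d_pt_comp cos (fun _ t => n * t)); [|cont2d].
      apply derivable_continuous, derivable_cos. }
    assert (Csin : continuity_2d_pt (fun _ t => sin (n * t)) r t).
    { apply (continuity_1d_2d_pt_comp sin (fun _ t => n * t)); [|cont2d].
      apply derivable_continuous, derivable_sin. }
    unfold a, b, rot_re, rot_im, p, q; split; cont2d. }
  assert (Hper : forall r t, a r (t + 2 * PI) = a r t /\ b r (t + 2 * PI) = b r t).
  { intros r t; unfold a, b, rot_re, rot_im.
    replace (n * (t + 2 * PI)) with (n * t + 2 * n * PI) by ring.
    replace (t + 2 * PI) with (t + 2 * INR 1 * PI) by (simpl; ring).
    unfold n; rewrite !cos_period, !sin_period; now split. }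
  assert (Hloc : forall (f : R -> R -> R) t r l, 0 < r < rad ->
    is_derive (fun s => f s t) r l -> is_derive (fun s => f (clamp 0 rad s) t) r l).
  { intros f t r l Hr; apply is_derive_ext_loc.
    apply (filter_imp (fun y => 0 < y < rad)); [|apply locally_between; lra].
    intros y Hy; now rewrite clamp_id by lra. }
  assert (Hsys : forall r t, 0 < r < rad -> exists ar at_ br bt,
    is_derive (fun s => a s t) r ar /\ is_derive (fun s => a r s) t at_ /\
    is_derive (fun s => b s t) r br /\ is_derive (fun s => b r s) t bt /\
    r * br + INR (S k) * b r t = at_ /\
    a r t * (a r t * at_ + b r t * bt)
    = b r t * (r * (a r t * ar + b r t * br)
               + INR k * (1 - a r t * a r t - b r t * b r t))).
  { intros r t Hr.
    assert (Ort : disk rad (r * cos t, r * sin t) /\ punctured (r * cos t) (r * sin t)).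
    { split; [unfold disk; rewrite Cmod_polar_coords; lra|].
      unfold punctured; rewrite polar_norm2; nra. }
    destruct (polar_system (fun x y => disk rad (x, y) /\ punctured x y) k p q
      (open_punctured_disk rad) (fun x y H => proj2 H)
      (fun x y H => proj1 (HPDE x y (proj1 H)))
      (fun x y H => proj1 (proj2 (HPDE x y (proj1 H))))
      (fun x y H => proj1 (proj2 (proj2 (HPDE x y (proj1 H)))))
      (fun x y H => proj2 (proj2 (proj2 (HPDE x y (proj1 H)))))
      (fun x y H => curl_free_relation rad k u x y hcurl HC2 (proj1 H) (proj2 H))
      r t ltac:(lra) Ort) as (ar & at_ & br & bt & D1 & D2 & D3 & D4 & E1 & E2).
    exists ar, at_, br, bt; fold n in D1, D2, D3, D4, E1, E2.
    unfold a, b; rewrite (clamp_id 0 rad r) by lra.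
    split; [now apply (Hloc (rot_re n p q))|].
    split; [exact D2|].
    split; [now apply (Hloc (rot_im n p q))|].
    split; [exact D4|split; [exact E1|exact E2]]. }
  assert (Hu : forall r t, 0 <= r <= rad ->
    p (r * cos t) (r * sin t) = a r t * cos (n * t) - b r t * sin (n * t) /\
    q (r * cos t) (r * sin t) = a r t * sin (n * t) + b r t * cos (n * t)).
  { intros r t Hr; unfold a, b, rot_re, rot_im; rewrite clamp_id by lra; split.
    - rewrite <- (Rmult_1_r (p _ _)) at 1; rewrite <- (Hn2 t); ring.
    - rewrite <- (Rmult_1_r (q _ _)) at 1; rewrite <- (Hn2 t); ring. }
  assert (Hnz : forall r t, 0 < r <= rad -> a r t <> 0 \/ b r t <> 0).
  { intros r t Hr.
    destruct (Req_dec (a r t) 0) as [Ea|Ea]; [|now left].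
    destruct (Req_dec (b r t) 0) as [Eb|Eb]; [|now right].
    exfalso; destruct (Hu r t) as [Hp Hq]; [lra|]; rewrite Ea, Eb in Hp, Hq.
    assert (Hd : closed_disk rad (r * cos t, r * sin t)).
    { unfold closed_disk; rewrite Cmod_polar_coords; lra. }
    assert (Z : u (r * cos t, r * sin t) = 0%C).
    { apply injective_projections; [change (p (r * cos t) (r * sin t) = 0); lra|].
      change (q (r * cos t) (r * sin t) = 0); lra. }
    apply (hzero _ Hd) in Z.
    assert (Cmod (r * cos t, r * sin t) = 0) by (rewrite Z; apply Cmod_0).
    rewrite Cmod_polar_coords in H; lra. }
  assert (Hab := disk_uniqueness k a b rad (fun r t _ => Hcont r t) Hper Hsys
    (fun t => proj2 (Hbd t))
    (fun t => eq_ind_r (fun x => 0 < x) Rlt_0_1 (proj1 (Hbd t))) Hnz).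
  (* The profile is read off on the ray [t = 0], where [a] equals [p]. As a restriction of [p], it
     has [dx p] and [dx (dx p)] as its derivatives inside the disk. *)
  set (F := fun r => p r 0).
  assert (HaF : forall r, 0 <= r <= rad -> a r 0 = F r).
  { intros r Hr; unfold a, rot_re, F; rewrite clamp_id by lra.
    rewrite !Rmult_0_r, cos_0, sin_0; rewrite Rmult_0_r, !Rmult_1_r, Rmult_0_r; ring. }
  assert (Hconst : forall r t, 0 < r <= rad -> a r t = F r).
  { intros r t Hr; rewrite <- HaF by lra.
    destruct (Req_dec r rad) as [->|Hne]; [now rewrite !(proj1 (Hbd _))|].
    assert (D : forall s, is_derive (fun s => a r s) s 0).
    { intros s; destruct (Hsys r s) as (ar & at_ & br & bt & _ & D2 & D3 & _ & E1 & _); [lra|].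
      (* [b] vanishes on all nearby circles, so its radial derivative does too, and the first
         relation of the system leaves [a_t = 0]. *)
      assert (br = 0).
      { apply (is_derive_inj _ _ _ _ D3).
        apply (is_derive_ext_loc (fun _ => 0)); [|exact (is_derive_const 0 r)].
        apply (filter_imp (fun y => 0 < y < rad)); [|apply locally_between; lra].
        intros y Hy; symmetry; apply Hab; lra. }
      rewrite (proj1 (Hab r s ltac:(lra))) in E1; subst br.
      apply (is_derive_eq _ _ _ _ D2); rewrite <- E1; eqR; ring. }
    destruct (Rtotal_order t 0) as [H|[->|H]]; [|reflexivity|].
    - apply (eq_is_derive (a r) t 0); [intros; apply D|exact H].
    - symmetry; apply (eq_is_derive (a r) 0 t); [intros; apply D|exact H]. }
  assert (Hpq : forall r t, 0 < r <= rad ->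
    p (r * cos t) (r * sin t) = F r * cos (n * t) /\
    q (r * cos t) (r * sin t) = F r * sin (n * t)).
  { intros r t Hr; destruct (Hu r t) as [Hp Hq]; [lra|].
    rewrite (proj1 (Hab r t Hr)), (Hconst r t Hr) in Hp, Hq; split; lra. }
  assert (Hu0 : u (0, 0) = 0%C).
  { apply hzero; [|reflexivity]; unfold closed_disk.
    replace ((0, 0) : C) with (RtoC 0) by reflexivity; rewrite Cmod_0; lra. }
  assert (HF0 : F 0 = 0) by (unfold F, p, comp1; now rewrite Hu0).
  assert (FPos : forall r, 0 < r <= rad -> 0 < F r).
  { intros r Hr; rewrite <- (Hconst r 0 Hr); now apply Hab. }
  assert (Hrs : radial_solution (S k) rad F).
  { split; [|split; [|split]].
    - apply continuous_on_segment_of_clamp; intros x.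
      apply (continuity_pt_ext (fun r => a (clamp 0 rad r) 0)).
      { intros r; apply HaF, clamp_bounds; lra. }
      apply (continuity_pt_comp (clamp 0 rad) (fun r => a r 0)); [apply clamp_continuity|].
      apply (continuity_2d_pt_section (fun t r => a r t) 0).
      destruct (Hcont (clamp 0 rad x) 0) as [Ca _]; intros eps.
      destruct (Ca eps) as [delta Hd]; exists delta; intros u' v' H1 H2; now apply Hd.
    - intros r Hr.
      assert (Hd : disk rad (r, 0)).
      { unfold disk; rewrite Cmod_pair; replace (r ^ 2 + 0 ^ 2) with (r ^ 2) by ring.
        rewrite sqrt_pow2; lra. }
      destruct (HPDE r 0 Hd) as (C2 & _ & E & _).
      destruct (ex_diff_2_derivs p r 0 C2) as ((D1 & _) & (D2 & _) & _).
      split; [now exists (dx p r 0)|].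
      split; [now exists (dx (dx p) r 0)|].
      (* The equation for the first component is evaluated at [(r, 0)], with [p_yy] expressed
         through the profile; [q] vanishes there, so [|u|^2] is [F r ^ 2]. *)
      rewrite (radial_reduction rad n p q F r Hr) in E; [| |intros t; apply Hpq; lra].
      2: { intros x y Hxy; now apply HPDE. }
      assert (Hq0 : q r 0 = 0).
      { destruct (Hpq r 0) as [_ Hq]; [lra|].
        rewrite !Rmult_0_r, cos_0, sin_0, Rmult_0_r, Rmult_1_r, Rmult_0_r in Hq; exact Hq. }
      rewrite Hq0 in E.
      change (- dx (dx p) r 0 - 1 / r * dx p r 0 + n ^ 2 / r ^ 2 * F r
        = F r * (1 - F r ^ 2)).
      change (p r 0) with (F r) in E.
      assert (E' : F r * (1 - F r ^ 2) = - ((F r * F r + 0 * 0 - 1) * F r)) by ring.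
      rewrite E', <- E; field; lra.
    - exact HF0.
    - rewrite <- (Hconst rad 0) by lra; apply Hbd. }
  exists F; split; [split; [split; [exact Hrs|]|]|].
  - intros r [[Hr| <-] Hr']; [left; apply FPos; lra|rewrite HF0; lra].
  - intros G HG; exact (radial_solution_unique (S k) rad F G hd hrad Hrs FPos HG).
  - intros r t Hr; rewrite polar_coords.
    assert (Z : p (r * cos t) (r * sin t) = F r * cos (n * t) /\
      q (r * cos t) (r * sin t) = F r * sin (n * t)).
    { destruct (Req_dec r 0) as [->|H0]; [|apply Hpq; lra].
      rewrite HF0, !Rmult_0_l; unfold p, q, comp1, comp2; rewrite Hu0; now split. }
    destruct Z as [Hp Hq]; apply injective_projections.
    + change (p (r * cos t) (r * sin t) = cos (n * t) * F r - sin (n * t) * 0); lra.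
    + change (q (r * cos t) (r * sin t) = cos (n * t) * 0 + sin (n * t) * F r); lra.
Qed.
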